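(* In the Gaussian sequence model $Y_j=\theta_j^0+\frac1{\sqrt n}\xi_j$, $j\ge1$, suppose that $\sum_{j=1}^{k_n}(\theta_j^0)^2$ is bounded (uniformly in $n$); this holds when $\theta^0$ is an element of $\ell^2(\mathbb{N})$ not depending on $n$. Take the prior $\widetilde W=\mathcal{N}(0,\tau_n^2I_{k_n})$ on $\theta\in\mathbb{R}^{k_n}$ with $\tau_n>0$ such that $n^{-1/4}=o(\tau_n)$. Then, for any sequence $k_n\le n$, $$E\left\|\widetilde W(d\theta\mid Y)-\mathcal{N}\left(\theta_Y,\tfrac1nI_{k_n}\right)\right\|_{\mathrm{TV}}\longrightarrow0\qquad\text{as }n\to\infty,$$ and the convergence rate of $\theta$ toward $\theta_0$ is $\sqrt{k_n/n}$: for every sequence $\lambda_n\to\infty$, $$E\left[\widetilde W\left(\|\theta-\theta_0\|\ge\lambda_n\sqrt{\tfrac{k_n}{n}}\ \Big|\ Y\right)\right]\longrightarrow0 .$$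
   Context: Gaussian sequence model: for each $n\ge1$ one observes $Y_j=\theta_j^0+n^{-1/2}\xi_j$, $j\ge1$, where $\xi_1,\xi_2,\dots$ are independent $\mathcal{N}(0,1)$ and $\theta^0=(\theta^0_j)_{j\ge1}$ is the true parameter; $E$ is expectation under this true distribution. For integers $1\le k_n\le n$ one uses the first $k_n$ coordinates: $\theta_0=(\theta_j^0)_{1\le j\le k_n}$ is the projection of $\theta^0$, and $\theta_Y=(Y_j)_{1\le j\le k_n}$. $\widetilde W(d\theta\mid Y)$ is the posterior distribution of $\theta\in\mathbb{R}^{k_n}$ when $\theta\sim\widetilde W$ and, conditionally on $\theta$, $(Y_j)_{1\le j\le k_n}\sim\mathcal{N}(\theta,\frac1nI_{k_n})$. $\|\cdot\|$ is the Euclidean norm and $\|Q-Q'\|_{\mathrm{TV}}=\sup_A|Q(A)-Q'(A)|$. *)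

(* Defs.v *)
From HB Require Import structures.
From mathcomp Require Import all_boot all_order all_algebra.
From mathcomp Require Import all_classical all_reals all_analysis.

Set Implicit Arguments.
Unset Strict Implicit.
Unset Printing Implicit Defensive.

Import Order.TTheory GRing.Theory Num.Theory.
Import numFieldNormedType.Exports.

Local Open Scope classical_set_scope.
Local Open Scope ring_scope.

(* R^k is represented by k.-tuple (measurableTypeR R), whose measurable sets
   are generated by the coordinate projections, i.e. the Borel sets of R^k. *)
Notation Rvec R k := (k.-tuple (measurableTypeR R)).

Section product_probability.
Context d (T : measurableType d) (R : realType).

Definition tuple_cons k (p : T * k.-tuple T) : k.+1.-tuple T :=
  [tuple of p.1 :: p.2].

Let measurable_tuple_cons k : measurable_fun setT (@tuple_cons k).
Proof. exact: measurable_cons. Qed.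

HB.instance Definition _ k :=
  @isMeasurableFun.Build _ _ _ _ (@tuple_cons k) (@measurable_tuple_cons k).

Fixpoint prod_prob k : ('I_k -> probability T R) -> probability (k.-tuple T) R :=
  match k with
  | 0%N => fun _ => \d_[tuple]
  | k'.+1 => fun P =>
      distribution (P ord0 \x prod_prob (fun i => P (lift ord0 i)))%E
                   (@tuple_cons k')
  end.

Lemma prod_prob_box k (P : 'I_k -> probability T R) (B : 'I_k -> set T) :
  (forall i, measurable (B i)) ->
  (prod_prob P [set x | forall i, B i (tnth x i)] = \prod_(i < k) P i (B i))%E.
Proof.
elim: k P B => [|k IH] P B mB.
  by rewrite big_ord0 /= diracE mem_set// => -[].
rewrite big_ord_recl -IH; last by move=> i; exact: mB.
rewrite /= /distribution /pushforward -product_measure1E//; last first.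
  rewrite (_ : [set x | _] =
      \big[setI/setT]_(i < k) ((@tnth k T)^~ i @^-1` B (lift ord0 i))).
    by apply: bigsetI_measurable => i _; rewrite -[X in measurable X]setTI;
       exact: measurable_tnth.
  rewrite -bigcap_seq; apply/seteqP; split=> x /= xB.
    by move=> i _; exact: xB.
  by move=> i; apply: xB => /=; rewrite mem_index_enum.
congr product_measure1; apply/seteqP; split=> -[a x] /=.
  move=> xB; split; first exact: (xB ord0).
  by move=> i; have := xB (lift ord0 i); rewrite /= tnthS.
move=> [aB xB] i; case: (unliftP ord0 i) => [j ->|->] //=.
by rewrite tnthS; exact: xB.
Qed.

End product_probability.

Section euclidean.
Context (R : realType).

Definition vsub k (x y : Rvec R k) : Rvec R k :=
  [tuple (tnth x i - tnth y i : R) | i < k].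

Definition enorm k (x : Rvec R k) : R :=
  Num.sqrt (\sum_(i < k) (tnth x i : R) ^+ 2).

(* s is the standard deviation: the law is N(m, s^2 I_k) for s <> 0. *)
Definition gaussian k (m : Rvec R k) (s : R) : probability (Rvec R k) R :=
  prod_prob (fun i : 'I_k => normal_prob (tnth m i) s).

Definition zerov k : Rvec R k := [tuple (0 : R) | _ < k].

End euclidean.

Definition tv_dist d (T : measurableType d) (R : realType)
    (mu nu : set T -> \bar R) : \bar R :=
  ereal_sup [set `|mu A - nu A|%E | A in [set A | measurable A]].

(* kappa is a regular conditional distribution of theta given Y, when
   theta ~ W and Y | theta ~ K theta: for all measurable A and B,
     Pr(theta \in A, Y \in B) = E[kappa(Y, A); Y \in B]. *)
Definition is_posterior d d' (Theta : measurableType d) (Y : measurableType d')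
    (R : realType) (W : probability Theta R) (K : Theta -> probability Y R)
    (kappa : R.-pker Y ~> Theta) : Prop :=
  forall (A : set Theta) (B : set Y), measurable A -> measurable B ->
    (\int[W]_(theta in A) K theta B =
     \int[W]_theta \int[K theta]_(y in B) kappa y A)%E.

Section gaussian_sequence_model.
Context d (Omega : measurableType d) (R : realType) (P : probability Omega R).

Definition mutually_independent (xi : nat -> {RV P >-> R}) : Prop :=
  forall (J : seq nat) (B : nat -> set R), uniq J ->
    (forall j, measurable (B j)) ->
    (P (\bigcap_(j in [set` J]) xi j @^-1` B j)
     = \prod_(j <- J) P (xi j @^-1` B j))%E.

Definition iid_standard_normal (xi : nat -> {RV P >-> R}) : Prop :=
  mutually_independent xi /\
  forall (j : nat) (A : set R), measurable A ->
    distribution P (xi j) A = normal_prob 0 1 A.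

(* theta0 n j is the coordinate number j.+1 of the true parameter in the
   n-th experiment. *)
Definition observation (theta0 : nat -> nat -> R) (xi : nat -> {RV P >-> R})
    (n j : nat) (w : Omega) : R :=
  theta0 n j + (Num.sqrt n%:R)^-1 * xi j w.

Definition theta_Y (theta0 : nat -> nat -> R) (xi : nat -> {RV P >-> R})
    (k : nat -> nat) (n : nat) (w : Omega) : Rvec R (k n) :=
  [tuple observation theta0 xi n j w | j < k n].

Definition proj_true (theta0 : nat -> nat -> R) (k : nat -> nat) (n : nat) :
  Rvec R (k n) := [tuple theta0 n j | j < k n].

Definition bounded_energy (theta0 : nat -> nat -> R) (k : nat -> nat) : Prop :=
  exists M : R, forall n, (0 < n)%N -> \sum_(j < k n) theta0 n j ^+ 2 <= M.

Definition in_ell2 (t : nat -> R) : Prop :=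
  cvgn (series (fun j => t j ^+ 2)).

End gaussian_sequence_model.

(* Main.v *)
Require Import Defs.
From HB Require Import structures.
From mathcomp Require Import all_boot all_order all_algebra.
From mathcomp Require Import all_classical all_reals all_analysis.
From mathcomp Require Import measurable_realfun ring lra.

(* Write sigma^2 = 1/n, rho^2 = sigma^2 + tau^2 and b = sigma^2 / rho^2. The
   marginal law of Y is N(0, rho^2 I), and by conjugacy the posterior is
   N((1 - b) Y, (1 - b) sigma^2 I); the given regular conditional probability
   agrees with it outside a null set of the marginal, hence, the Gaussian laws
   being mutually absolutely continuous, almost surely under the true law.
   The chi-square divergence of this posterior from N(Y, sigma^2 I) factors over
   the coordinates and is at most exp(k b^2 + n b^2 |Y|^2) - 1. As k <= n and
   E|Y|^2 is bounded, the expected exponent is O(n b^2) = O(1 / (n tau^4)), which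
   tends to 0 exactly because n^(-1/4) = o(tau). The contraction rate follows
   by Markov's inequality for N(Y, sigma^2 I). *)

Set Implicit Arguments.
Unset Strict Implicit.
Unset Printing Implicit Defensive.

Import Order.TTheory GRing.Theory Num.Theory.
Import numFieldNormedType.Exports.

Local Open Scope classical_set_scope.
Local Open Scope ring_scope.

(** * Densities and product measures *)

(** For each set A, [is_posterior] fixes the kernel only up to a null set of data that may depend on
    A, whereas total variation is a supremum over uncountably many A. The identification with the
    conjugate posterior must therefore produce a single null set. Measurability of the total
    variation in the data is not established either, so its integral is only bounded from above.
    Bayes' formula is used without a normalising constant: against the reference laws N(0, rho^2 I)
    for Y and N(0, tau^2 I) for theta, one and the same function of (theta, y) is the density of the
    data given theta and of theta given the data. The expectation of exp(n b^2 |Y|^2) is never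
    taken. A free parameter t > 0 gives, almost surely, a bound of the form t / 2 + exponent / t,
    which is then made affine in the noise energy |Y - theta_0|^2. Only second moments of the noise
    remain, and the same bound feeds both conclusions. The parameter t is fixed first, and n grows
    afterwards. *)

Section density.
Context d (T : measurableType d) (R : realType).

(** [p] has the same integral as the Radon-Nikodym derivative of [nu] over every measurable set,
    hence equals it almost everywhere, and the change of variables for the derivative carries
    over. *)
Lemma ge0_integral_density (nu : {finite_measure set T -> \bar R})
    (mu : {sigma_finite_measure set T -> \bar R}) (p : T -> R)
    (f : T -> \bar R) (E : set T) :
  measurable_fun setT p -> (forall x, 0 <= p x) ->
  (forall A, measurable A -> nu A = \int[mu]_(x in A) (p x)%:E)%E ->
  measurable E -> measurable_fun E f -> (forall x, (0 <= f x)%E) ->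
  (\int[nu]_(x in E) f x = \int[mu]_(x in E) (f x * (p x)%:E))%E.
Proof.
move=> mp p0 nuE mE mf f0.
have dom : nu `<< mu.
  apply/null_content_dominatesP => A mA muA0; rewrite nuE//.
  apply: null_set_integral => //.
  exact/measurable_funTS/measurable_EFinP.
rewrite -(Radon_Nikodym_SigmaFinite.change_of_variables dom)//.
apply: ae_eq_integral => //.
- apply: emeasurable_funM => //; apply: measurable_funTS.
  exact: measurable_int (Radon_Nikodym_SigmaFinite.f_integrable dom).
- by apply: emeasurable_funM => //; exact/measurable_funTS/measurable_EFinP.
apply: ae_eqe_mul2l; apply: (@ae_eq_subset _ _ _ _ _ setT) => //.
apply: integral_ae_eq => //.
- exact: Radon_Nikodym_SigmaFinite.f_integrable.
- exact/measurable_EFinP.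
- move=> A _ mA.
  by rewrite -Radon_Nikodym_SigmaFinite.f_integral// nuE.
Qed.

Import HBNNSimple.

(* [f] need not be measurable: [tv_dist] is a supremum over uncountably many
   sets. *)
Lemma le_ge0_integral_ae (mu : {measure set T -> \bar R}) (f g : T -> \bar R) :
  (forall x, (0 <= f x)%E) -> (forall x, (0 <= g x)%E) ->
  measurable_fun setT g ->
  {ae mu, forall x, (f x <= g x)%E} ->
  (\int[mu]_x f x <= \int[mu]_x g x)%E.
Proof.
move=> f0 g0 mg [N [mN muN fgN]].
rewrite ge0_integralTE//; apply: ge_ereal_sup => _ [h hf <-].
rewrite -integralT_nnsfun; apply: ae_ge0_le_integral => //.
- by move=> x _; rewrite lee_fin; exact: fun_ge0.
- exact/measurable_EFinP/measurable_funP.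
exists N; split => // x /= hx; apply: fgN => /= fx; apply: hx => _.
exact: le_trans (hf x) fx.
Qed.

End density.

Section tuple_boxes.
Context d (T : measurableType d) (k : nat).

Definition box (B : 'I_k -> set T) : set (k.-tuple T) :=
  [set x | forall i, B i (tnth x i)].

Lemma measurable_box (B : 'I_k -> set T) :
  (forall i, measurable (B i)) -> measurable (box B).
Proof.
move=> mB; rewrite (_ : box B =
    \big[setI/setT]_(i < k) ((@tnth k T)^~ i @^-1` B i)).
  by apply: bigsetI_measurable => i _; rewrite -[X in measurable X]setTI;
     exact: measurable_tnth.
rewrite -bigcap_seq; apply/seteqP; split=> x /= xB.
  by move=> i _; exact: xB.
by move=> i; apply: xB => /=; rewrite mem_index_enum.
Qed.

Lemma indic_box (R : realType) (B : 'I_k -> set T) (x : k.-tuple T) :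
  \1_(box B) x = \prod_(i < k) \1_(B i) (tnth x i) :> R.
Proof.
have [xB|/existsNP[i xNB]] := pselect (box B x).
  by rewrite indicE mem_set// big1// => i _; rewrite indicE mem_set//; exact: xB.
rewrite indicE memNset; last by move=> /(_ i).
by rewrite (bigD1 i)//= indicE memNset// mul0r.
Qed.

Context (R : realType) (C : set (set T)).
Hypotheses (mC : measurable = <<s C >>) (CI : setI_closed C) (CT : C setT).

(** Boxes with sides in a generating pi-system form a generating pi-system of the product. The class
    [C] is kept general for two uses: all measurable sides for product laws, and countably many
    sides for the uniform null set of the posterior. *)
Lemma eq_measure_boxes (m1 m2 : {measure set (k.-tuple T) -> \bar R}) :
  (m1 setT < +oo)%E ->
  (forall B : 'I_k -> set T, (forall i, C (B i)) -> m1 (box B) = m2 (box B)) ->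
  forall A, measurable A -> m1 A = m2 A.
Proof.
move=> m1oo m12; pose G := [set A | exists2 B, (forall i, C (B i)) & A = box B].
have CM B : C B -> measurable B by move=> CB; rewrite mC; exact: sub_sigma_algebra.
have GM : G `<=` measurable.
  by move=> _ [B CB ->]; apply: measurable_box => i; exact/CM/CB.
have mG : @measurable _ (k.-tuple T) = <<s G >>.
  apply/seteqP; split; last first.
    by apply: smallest_sub => //; exact: sigma_algebra_measurable.
  apply: smallest_sub; first exact: smallest_sigma_algebra.
  rewrite -bigcup_seq => _ [i _ [Y mY <-]] /=.
  have /(_ Y) : @measurable _ T `<=`
      image_set_system setT (@tnth k T ^~ i) <<s G >>; last exact.
  rewrite mC; apply: smallest_sub.
    exact/sigma_algebra_image/smallest_sigma_algebra.
  (* A cylinder is the box with [D] in slot [i] and the whole space elsewhere, which is where [setT]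
     must belong to [C]. *)
  move=> D CD; apply: sub_sigma_algebra; exists (fun j => if j == i then D else setT).
    by move=> j; case: ifP.
  apply/seteqP; split => x /=.
    by move=> [_ Dx] j; case: eqP => // ->.
  by move=> /(_ i); rewrite eqxx.
apply: (measure_unique G (fun=> setT)) => //.
- move=> _ _ [B CB ->] [D CD ->]; exists (fun i => B i `&` D i).
    by move=> i; exact: CI.
  by apply/seteqP; split => x /= => [[xB xD] i|xBD]; [|split => i; have [] := xBD i].
- move=> _; exists (fun=> setT) => //.
  by apply/seteqP; split.
- exact: bigcup_const.
- by move=> _ [B CB ->]; exact: m12.
Qed.

End tuple_boxes.

Section product_probability.
Context d (T : measurableType d) (R : realType).

Lemma measurable_prod_tnth k (f : 'I_k -> T -> R) :
  (forall i, measurable_fun setT (f i)) ->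
  measurable_fun setT (fun x : k.-tuple T => \prod_(i < k) f i (tnth x i)).
Proof.
move=> mf; apply: measurable_prod => i _.
by apply: measurableT_comp; [exact: mf|exact: measurable_tnth].
Qed.

Lemma integral_prod_prob k (P : 'I_k -> probability T R) (f : 'I_k -> T -> R) :
  (forall i, measurable_fun setT (f i)) -> (forall i x, 0 <= f i x) ->
  (\int[prod_prob P]_x (\prod_(i < k) f i (tnth x i))%:E =
   \prod_(i < k) \int[P i]_x (f i x)%:E)%E.
Proof.
elim: k P f => [|k IH] P f mf f0.
  rewrite big_ord0 integral_dirac//; last first.
    by apply/measurable_EFinP; exact: measurable_prod_tnth.
  by rewrite diracE mem_set// mul1e big_ord0.
rewrite big_ord_recl -IH//= ge0_integral_pushforward//=; last 2 first.
- by apply/measurable_EFinP; exact: measurable_prod_tnth.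
- by move=> x _; rewrite lee_fin prodr_ge0.
have mg : measurable_fun setT
    (fun x : k.-tuple T => \prod_(i < k) f (lift ord0 i) (tnth x i)).
  exact: (@measurable_prod_tnth _ (fun i => f (lift ord0 i))).
rewrite preimage_setT fubini_tonelli1; last 2 first.
- apply: (measurableT_comp
      (f := fun x : k.+1.-tuple T => (\prod_i f i (tnth x i))%:E)).
    by apply/measurable_EFinP; exact: measurable_prod_tnth.
  exact: measurable_cons.
- by move=> x; rewrite lee_fin prodr_ge0.
rewrite /fubini_F/=.
under eq_integral => x _.
  rewrite (_ : integral _ _ _ = (f ord0 x)%:E *
      \int[prod_prob (fun i => P (lift ord0 i))]_y
        (\prod_(i < k) f (lift ord0 i) (tnth y i))%:E)%E; last first.
    rewrite -ge0_integralZl//; last 3 first.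
    - exact/measurable_EFinP.
    - by move=> y _; rewrite lee_fin prodr_ge0.
    - by rewrite lee_fin.
    apply: eq_integral => y _.
    rewrite big_ord_recl/= EFinM tnth0.
    by under eq_bigr do rewrite tnthS.
  over.
rewrite ge0_integralZr//.
- exact/measurable_EFinP.
- by move=> x _; rewrite lee_fin.
- by apply: integral_ge0 => y _; rewrite lee_fin prodr_ge0.
Qed.

Lemma eq_prod_prob_boxes k (P : 'I_k -> probability T R)
    (m : probability (k.-tuple T) R) :
  (forall B : 'I_k -> set T, (forall i, measurable (B i)) ->
    m (box B) = \prod_(i < k) P i (B i))%E ->
  forall A, measurable A -> m A = prod_prob P A.
Proof.
move=> mE; apply: (@eq_measure_boxes _ _ _ _ measurable) => //.
- by rewrite sigma_algebra_id//; exact: sigma_algebra_measurable.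
- exact: measurableI.
- by rewrite ltey_eq fin_num_measure.
- by move=> B mB; rewrite [RHS]prod_prob_box//; exact: mE.
Qed.

(** The product density defines a probability measure; on a box the indicator is itself a product,
    so the integral factors and uniqueness on boxes concludes. *)
Lemma prod_prob_density k (P Q : 'I_k -> probability T R) (f : 'I_k -> T -> R) :
  (forall i, measurable_fun setT (f i)) -> (forall i x, 0 <= f i x) ->
  (forall i A, measurable A -> P i A = \int[Q i]_(x in A) (f i x)%:E)%E ->
  forall A, measurable A ->
    (prod_prob P A =
     \int[prod_prob Q]_(x in A) (\prod_(i < k) f i (tnth x i))%:E)%E.
Proof.
move=> mf f0 PE A mA.
pose m A := (\int[prod_prob Q]_(x in A) (\prod_(i < k) f i (tnth x i))%:E)%E.
have mpf : measurable_fun setT (fun x : k.-tuple T =>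
    (\prod_(i < k) f i (tnth x i))%:E).
  by apply/measurable_EFinP; exact: measurable_prod_tnth.
have pf0 x : (0 <= (\prod_(i < k) f i (tnth x i))%:E)%E.
  by rewrite lee_fin prodr_ge0.
have m0 : m set0 = 0%E by rewrite /m integral_set0.
have mge0 B : (0 <= m B)%E by exact: integral_ge0.
have msigma : semi_sigma_additive m.
  move=> /= F mF tF mUF; rewrite /m ge0_integral_bigcup//; last first.
    exact: measurable_funTS.
  by apply: is_cvg_ereal_nneg_natsum_cond => n _ _; exact: mge0.
have mT : m setT = 1%E.
  rewrite /m integral_prod_prob// big1// => i _.
  by rewrite -PE// probability_setT.
pose mixM := isMeasure.Build _ _ _ m m0 mge0 msigma.
pose M : {measure set (k.-tuple T) -> \bar R} := HB.pack m mixM.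
pose mixP := @Measure_isProbability.Build _ _ R M mT.
pose MP : probability (k.-tuple T) R := HB.pack (Measure.sort M) mixP.
apply/esym; apply: (@eq_prod_prob_boxes _ _ MP) => // B mB.
rewrite /= /m integral_mkcond.
transitivity (\int[prod_prob Q]_x
    (\prod_(i < k) (f i (tnth x i) * \1_(B i) (tnth x i)))%:E)%E.
  apply: eq_integral => x _; rewrite big_split/= -indic_box EFinM.
  by rewrite epatch_indic.
rewrite (@integral_prod_prob _ Q (fun i y => f i y * \1_(B i) y)).
- apply: eq_bigr => i _; rewrite PE// [RHS]integral_mkcond.
  by apply: eq_integral => y _; rewrite epatch_indic.
- by move=> i; apply: measurable_funM.
- by move=> i x; rewrite mulr_ge0.
Qed.

End product_probability.

(** * Uniqueness of the posterior *)

Section bayes.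
Context d d' (Theta : measurableType d) (Y : measurableType d') (R : realType).
Variables (W : probability Theta R) (nu : probability Y R).
Variables (K : Theta -> probability Y R) (post : Y -> probability Theta R).
Variables (r : Theta * Y -> R) (kappa : R.-pker Y ~> Theta).
Hypotheses (mr : measurable_fun setT r) (r0 : forall z, 0 <= r z).
Hypothesis KE : forall t B, measurable B ->
  (K t B = \int[nu]_(y in B) (r (t, y))%:E)%E.
Hypothesis postE : forall y A, measurable A ->
  (post y A = \int[W]_(t in A) (r (t, y))%:E)%E.
Hypothesis kappaP : is_posterior W K kappa.

Let mrl t : measurable_fun setT (fun y => r (t, y)).
Proof. exact: measurableT_comp. Qed.

Let mrr y : measurable_fun setT (fun t => r (t, y)).
Proof. exact: measurableT_comp. Qed.

Let integral_likelihood (f : Theta -> \bar R) (g : Y -> \bar R) :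
  measurable_fun setT f -> (forall t, (0 <= f t)%E) ->
  measurable_fun setT g -> (forall y, (0 <= g y)%E) ->
  (\int[W]_t (f t * \int[nu]_y (g y * (r (t, y))%:E)) =
   \int[nu]_y (g y * \int[W]_t (f t * (r (t, y))%:E)))%E.
Proof.
move=> mf f0 mg g0.
have mrE : measurable_fun setT (EFin \o r) by exact/measurable_EFinP.
have mfg : measurable_fun setT (fun z => f z.1 * (g z.2 * (r z)%:E))%E.
  apply: emeasurable_funM; first exact: measurableT_comp.
  by apply: emeasurable_funM => //; exact: measurableT_comp.
transitivity (\int[W]_t \int[nu]_y (f t * (g y * (r (t, y))%:E)))%E.
  apply: eq_integral => t _; rewrite ge0_integralZl//.
  - by apply: emeasurable_funM => //; exact/measurable_EFinP.
  - by move=> y _; rewrite mule_ge0// lee_fin.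
rewrite (fubini_tonelli (fun z => f z.1 * (g z.2 * (r z)%:E))%E)//; last first.
  by move=> z; rewrite !mule_ge0// lee_fin.
apply: eq_integral => y _ /=; rewrite -ge0_integralZl//; last 2 first.
- by apply: emeasurable_funM => //; exact/measurable_EFinP.
- by move=> t _; rewrite mule_ge0// lee_fin.
by apply: eq_integral => t _; rewrite muleCA.
Qed.

Let integral_setE d0 (T : measurableType d0) (m : {measure set T -> \bar R})
    (f : T -> \bar R) A :
  (\int[m]_(x in A) f x = \int[m]_x ((\1_A x)%:E * f x))%E.
Proof.
rewrite integral_mkcond; apply: eq_integral => x _.
by rewrite epatch_indic muleC.
Qed.

(** [kappa ^~ A] and [post ^~ A] have the same integral over every [B]: both equal the joint
    probability of A and B, by Tonelli on one side and by the defining identity of the posterior on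
    the other. *)
Lemma posterior_ae_eq_set (A : set Theta) : measurable A ->
  {ae nu, forall y, kappa y A = post y A}.
Proof.
move=> mA.
have mi d0 (T : measurableType d0) (B : set T) : measurable B ->
    measurable_fun setT (EFin \o \1_B : T -> \bar R).
  by move=> mB; exact/measurable_EFinP.
have i0 d0 (T : measurableType d0) (B : set T) x : (0 <= (\1_B x)%:E :> \bar R)%E.
  by rewrite lee_fin.
have mk : measurable_fun setT (kappa ^~ A) by exact: measurable_kernel.
have mpost : measurable_fun setT (fun y => post y A).
  under eq_fun do rewrite postE// integral_setE.
  apply: (@measurable_fun_fubini_tonelli_G _ _ _ _ _ W
    (fun z : Theta * Y => (\1_A z.1)%:E * (r z)%:E)%E).
    apply: emeasurable_funM; last exact/measurable_EFinP.
    exact: (measurableT_comp (mi _ _ _ mA)).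
  by move=> z; rewrite mule_ge0// lee_fin.
suff : ae_eq nu setT (fun y => post y A) (kappa ^~ A).
  by apply: filterS => y /(_ I).
apply: integral_ae_eq => //.
  apply: (@le_integrable _ _ _ _ _ _ _ (cst 1%E)) => //.
    by move=> y _; rewrite gee0_abs// abse1; exact: probability_le1.
  exact: finite_measure_integrable_cst.
move=> B _ mB.
transitivity (\int[W]_(t in A) K t B)%E.
  rewrite integral_setE.
  transitivity (\int[W]_t ((\1_A t)%:E *
      \int[nu]_y ((\1_B y)%:E * (r (t, y))%:E)))%E; last first.
    rewrite [RHS]integral_setE; apply: eq_integral => t _.
    by rewrite KE// (integral_setE _ _ B).
  rewrite integral_likelihood//; try exact: mi.
  by apply: eq_integral => y _; rewrite postE// integral_setE.
rewrite kappaP//.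
transitivity (\int[W]_t (1 * \int[nu]_y (((\1_B y)%:E * kappa y A) * (r (t, y))%:E)))%E.
  apply: eq_integral => t _; rewrite mul1e.
  rewrite (ge0_integral_density (mu := nu) (p := fun y => r (t, y)))//.
  - by rewrite integral_setE; apply: eq_integral => y _; rewrite muleA.
  - exact: KE.
  - exact: measurable_funTS.
rewrite (integral_likelihood (f := cst 1%E) (g := fun y => ((\1_B y)%:E * kappa y A)%E))//.
- rewrite integral_setE; apply: eq_integral => y _.
  (* Total mass one of [post y] says that [nu] is the marginal law of the data. *)
  rewrite (_ : integral _ _ _ = 1%E) ?mule1//.
  transitivity (post y setT); last exact: probability_setT.
  by rewrite postE//; apply: eq_integral => t _; rewrite mul1e.
- by apply: emeasurable_funM => //; exact: mi.
Qed.

End bayes.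

Section rational_rays.
Context (R : realType).

(** [None] stands for the whole line, so that a box may leave coordinates unconstrained while the
    index type stays countable. *)
Definition rat_ray (q : option rat) : set R :=
  if q is Some q then [set x | x < ratr q] else setT.

Lemma measurable_rat_ray q : @measurable _ (measurableTypeR R) (rat_ray q).
Proof.
case: q => [q|] //=; rewrite (_ : [set x | _] = `]-oo, ratr q[%classic).
  exact: measurable_itv.
by apply/seteqP; split => x /=; rewrite in_itv.
Qed.

Lemma measurable_rat_rayE :
  @measurable _ (measurableTypeR R) = <<s range rat_ray >>.
Proof.
apply/seteqP; split; last first.
  apply: smallest_sub; first exact: sigma_algebra_measurable.
  by move=> _ [q _ <-]; exact: measurable_rat_ray.
rewrite [X in X `<=` _]RGenInftyO.measurableE.
apply: smallest_sub; first exact: smallest_sigma_algebra.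
move=> _ [x ->].
rewrite (_ : `]-oo, x[%classic = \bigcup_(q : rat)
   (if ratr q <= x then rat_ray (Some q) else set0)); last first.
  apply/seteqP; split => y /=; rewrite in_itv/=.
    move=> /rat_in_itvoo[q]; rewrite in_itv/= => /andP[yq qx].
    by exists q => //; rewrite (ltW qx).
  by move=> [q _]; case: ifPn => // qx /= /lt_le_trans; exact.
apply: (@bigcupT_measurable_rat _ (g_sigma_algebraType (range rat_ray))) => q.
case: ifP => _; last exact: measurable0.
by apply: sub_sigma_algebra; exists (Some q).
Qed.

Lemma rat_rayI : setI_closed (range rat_ray).
Proof.
move=> _ _ [[p|] _ <-] [[q|] _ <-] /=.
- exists (Some (Order.min p q)) => //=.
  apply/seteqP; split => x /=.
    by case: (leP p q) => [pq|/ltW qp] xm; split => //; apply: (lt_le_trans xm);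
      rewrite ler_rat.
  by move=> [xp xq]; case: (leP p q).
- by exists (Some p) => //; rewrite setIT.
- by exists (Some q) => //; rewrite setTI.
- by exists None => //; rewrite setTI.
Qed.

End rational_rays.

(* The null set does not depend on [A], since boxes with rational sides form a
   countable generating pi-system. *)
Lemma posterior_ae_eq d (Y : measurableType d) (R : realType) k
    (W : probability (Rvec R k) R) (nu : probability Y R)
    (K : Rvec R k -> probability Y R) (post : Y -> probability (Rvec R k) R)
    (r : Rvec R k * Y -> R) (kappa : R.-pker Y ~> (Rvec R k)) :
  measurable_fun setT r -> (forall z, 0 <= r z) ->
  (forall t B, measurable B -> K t B = \int[nu]_(y in B) (r (t, y))%:E)%E ->
  (forall y A, measurable A -> post y A = \int[W]_(t in A) (r (t, y))%:E)%E ->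
  is_posterior W K kappa ->
  {ae nu, forall y A, measurable A -> kappa y A = post y A}.
Proof.
move=> mr r0 KE postE kappaP.
pose B (q : {ffun 'I_k -> option rat}) := box (fun i => @rat_ray R (q i)).
have mB q : measurable (B q).
  by apply: measurable_box => i; exact: measurable_rat_ray.
(* Enumerating the rational boxes by [unpickle] turns the countable intersection of full-measure
   events into one event. *)
have : {ae nu, forall y n, if unpickle n is Some q then
    kappa y (B q) = post y (B q) else True}.
  apply: ae_foralln => n; case: unpickle => [q|]; last exact: aeW.
  exact: posterior_ae_eq_set mr r0 KE postE kappaP _ (mB q).
apply: filterS => y yB.
apply: (@eq_measure_boxes _ _ k R _ (measurable_rat_rayE R) (@rat_rayI R)).
- by exists None.
- by rewrite prob_kernel ltry.
move=> C CP; have /choice[q qC] : forall i, exists q, @rat_ray R q = C i.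
  by move=> i; have [q _ qC] := CP i; exists q.
have := yB (pickle (finfun q)); rewrite pickleK.
by rewrite (_ : B _ = box C)//; congr box; apply/funext => i; rewrite ffunE.
Qed.

(** * Total variation from a second-moment bound on the density *)

Section total_variation.
Context d (T : measurableType d) (R : realType) (p q : probability T R).

Lemma tv_dist_ge0 (mu nu : {measure set T -> \bar R}) : (0 <= tv_dist mu nu)%E.
Proof.
apply: ereal_sup_ubound; exists set0; first exact: measurable0.
by rewrite !measure0 sube0 abse0.
Qed.

Lemma abse_prob_sub_le1 (A : set T) : measurable A -> (`|p A - q A| <= 1)%E.
Proof.
move=> mA.
have [pf qf] : p A \is a fin_num /\ q A \is a fin_num by rewrite !fin_num_measure.
have [p0 q0] : (0 <= p A)%E /\ (0 <= q A)%E by [].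
have [p1 q1] : (p A <= 1)%E /\ (q A <= 1)%E by rewrite !probability_le1.
rewrite -(fineK pf) -(fineK qf) in p0 q0 p1 q1 *.
move: p0 q0 p1 q1; rewrite !lee_fin /= ler_norml => *; lra.
Qed.

(* Pointwise AM-GM, [|f - 1| <= t / 2 + (f - 1) ^ 2 / (2 t)], replaces the
   Cauchy-Schwarz inequality. *)
Lemma abse_prob_sub_le (f : T -> R) (V t : R) (A : set T) :
  measurable_fun setT f -> (forall x, 0 <= f x) ->
  (forall A, measurable A -> p A = \int[q]_(x in A) (f x)%:E)%E ->
  (\int[q]_x (f x ^+ 2)%:E <= V%:E)%E -> 0 < t -> measurable A ->
  (`|p A - q A| <= (t / 2 + (V - 1) / (2 * t))%:E)%E.
Proof.
move=> mf f0 pE fV t0 mA.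
(* [h] dominates both [f - 1] and [1 - f]; the completed squares [hB] and [hD] below show it. *)
pose h x := t / 2 + (f x - 1) ^+ 2 / (2 * t).
have mf2 : measurable_fun setT (fun x => f x ^+ 2) by exact: measurable_funX.
have mh : measurable_fun setT h.
  apply: measurable_funD => //; apply: measurable_funM => //.
  by apply: measurable_funX; exact: measurable_funB.
have h0 x : 0 <= h x.
  by rewrite addr_ge0 ?divr_ge0 ?sqr_ge0//; lra.
have hB x : h x = f x - 1 + (f x - 1 - t) ^+ 2 / (2 * t).
  by rewrite /h; field; rewrite gt_eqF.
have hD x : h x = 1 - f x + (f x - 1 + t) ^+ 2 / (2 * t).
  by rewrite /h; field; rewrite gt_eqF.
have s0 x : 0 <= x ^+ 2 / (2 * t) by rewrite divr_ge0 ?sqr_ge0//; lra.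
have mfE B : measurable_fun B (EFin \o f) by exact/measurable_EFinP/measurable_funTS.
have mhE B : measurable_fun B (EFin \o h) by exact/measurable_EFinP/measurable_funTS.
have f0E B x : B x -> (0 <= (f x)%:E)%E by rewrite lee_fin.
have h0E B x : B x -> (0 <= (h x)%:E)%E by rewrite lee_fin.
have [fT hT fA hA] := And4 (f0E setT) (h0E setT) (f0E A) (h0E A).
have H : (\int[q]_x (h x)%:E <= (t / 2 + (V - 1) / (2 * t))%:E)%E.
  (* Expanding the square in [h] leaves a negative term [- f / t]. Since [f] integrates to 1, adding
     [t^-1] to both sides cancels it and keeps every integrand nonnegative. *)
  rewrite -(@leeD2rE _ (t^-1)%:E)//.
  have -> : (\int[q]_x (h x)%:E + t^-1%:E =
             \int[q]_x ((h x)%:E + t^-1%:E * (f x)%:E))%E.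
    rewrite ge0_integralD//; last 2 first.
    - by move=> x _; rewrite -EFinM lee_fin mulr_ge0 ?invr_ge0// ltW.
    - exact: emeasurable_funM.
    rewrite ge0_integralZl//; last by rewrite lee_fin invr_ge0 ltW.
    by rewrite -pE// probability_setT mule1.
  under eq_integral => x _.
    rewrite (_ : _ + _ = (t / 2 + (2 * t)^-1)%:E + (2 * t)^-1%:E * (f x ^+ 2)%:E)%E; last first.
      by rewrite -!EFinM -!EFinD /h; congr EFin; field; rewrite gt_eqF.
    over.
  have t20 : 0 <= (2 * t)^-1 by rewrite invr_ge0; lra.
  have c0 : 0 <= t / 2 + (2 * t)^-1 by rewrite addr_ge0//; lra.
  rewrite ge0_integralD//; last 2 first.
  - by move=> x _; rewrite -EFinM lee_fin mulr_ge0 ?sqr_ge0.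
  - by apply: emeasurable_funM => //; exact/measurable_EFinP.
  rewrite ge0_integralZl//; last 2 first.
  - exact/measurable_EFinP.
  - by move=> x _; rewrite lee_fin sqr_ge0.
  rewrite integral_cst// [X in (_ * X)%E](_ : _ = 1%E) ?mule1; last exact: probability_setT.
  apply: (@le_trans _ _ ((t / 2 + (2 * t)^-1)%:E + (2 * t)^-1%:E * V%:E)%E).
    by rewrite leeD2l// lee_wpmul2l.
  rewrite -!EFinM -!EFinD lee_fin le_eqVlt; apply/orP; left; apply/eqP.
  by field; rewrite gt_eqF.
have HA : (\int[q]_(x in A) (h x)%:E <= (t / 2 + (V - 1) / (2 * t))%:E)%E.
  apply: le_trans H; apply: ge0_subset_integral => //.
have pq : (p A <= q A + \int[q]_(x in A) (h x)%:E)%E.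
  rewrite pE// -[q A]mul1e -integral_cst// -ge0_integralD//.
  apply: ge0_le_integral => //.
  - exact: emeasurable_funD.
  - by move=> x _; rewrite -EFinD lee_fin hB; have := s0 (f x - 1 - t); lra.
have qp : (q A <= p A + \int[q]_(x in A) (h x)%:E)%E.
  rewrite pE// -[q A]mul1e -integral_cst// -ge0_integralD//.
  apply: ge0_le_integral => //.
  - exact: emeasurable_funD.
  - by move=> x _; rewrite -EFinD lee_fin hD; have := s0 (f x - 1 + t); lra.
have {}pq := le_trans pq (leeD2l (q A) HA).
have {}qp := le_trans qp (leeD2l (p A) HA).
have [pf qf] : p A \is a fin_num /\ q A \is a fin_num by rewrite !fin_num_measure.
rewrite -(fineK pf) -(fineK qf) in pq qp *.
move: pq qp; rewrite -!EFinD !lee_fin /= ler_norml => *; lra.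
Qed.

End total_variation.

(** * Normal distributions *)

Section normal.
Context (R : realType).
Implicit Types m s t x y b : R.
Local Notation mu := (@lebesgue_measure R).

Lemma normal_pdf_expR m s x : 0 < s ->
  normal_pdf m s x =
  (Num.sqrt (pi *+ 2))^-1 / s * expR (- ((x - m) ^+ 2 / (2 * s ^+ 2))).
Proof.
move=> s0; rewrite normal_pdfE ?gt_eqF// /normal_peak /normal_fun.
rewrite -mulrnAr sqrtrM ?sqr_ge0// sqrtr_sqr gtr0_norm// invfM mulrC.
by rewrite [LHS]mulrC (mulrC s^-1) mulNr mulr_natl.
Qed.

Lemma sqrt_2pi_gt0 : 0 < Num.sqrt (pi *+ 2) :> R.
Proof. by rewrite sqrtr_gt0 mulrn_wgt0// pi_gt0. Qed.

Lemma normal_pdf_gt0 m s x : 0 < s -> 0 < normal_pdf m s x.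
Proof.
move=> s0; rewrite normal_pdf_expR// mulr_gt0 ?expR_gt0// divr_gt0//.
by rewrite invr_gt0 sqrt_2pi_gt0.
Qed.

(** A density relative to another normal law rather than to Lebesgue measure, because
    [prod_prob_density] takes probability measures as references. *)
Definition normal_lr m1 s1 m2 s2 x := normal_pdf m1 s1 x / normal_pdf m2 s2 x.

Lemma normal_lr_ge0 m1 s1 m2 s2 x : 0 <= normal_lr m1 s1 m2 s2 x.
Proof. by rewrite divr_ge0// normal_pdf_ge0. Qed.

Lemma normal_lr_expR m1 s1 m2 s2 x : 0 < s1 -> 0 < s2 ->
  normal_lr m1 s1 m2 s2 x = s2 / s1 *
    expR ((x - m2) ^+ 2 / (2 * s2 ^+ 2) - (x - m1) ^+ 2 / (2 * s1 ^+ 2)).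
Proof.
move=> s10 s20; rewrite /normal_lr !normal_pdf_expR// expRD !expRN.
have := expR_gt0 ((x - m1) ^+ 2 / (2 * s1 ^+ 2)).
have := expR_gt0 ((x - m2) ^+ 2 / (2 * s2 ^+ 2)).
have := sqrt_2pi_gt0.
set a := Num.sqrt _; set e1 := expR _; set e2 := expR _ => a0 e10 e20.
by field; rewrite !gt_eqF//.
Qed.

Lemma integral_normal_prob m s (A : set (measurableTypeR R)) (f : R -> R) :
  measurable A -> measurable_fun setT f -> (forall x, 0 <= f x) ->
  (\int[normal_prob m s]_(x in A) (f x)%:E =
   \int[mu]_(x in A) (f x * normal_pdf m s x)%:E)%E.
Proof.
move=> mA mf f0.
rewrite (ge0_integral_density (mu := mu) (p := normal_pdf m s))//.
- exact: measurable_normal_pdf.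
- by move=> x; exact: normal_pdf_ge0.
- exact/measurable_EFinP/measurable_funTS.
Qed.

Lemma measurable_normal_lr d (T : measurableType d) (m x : T -> R) s1 m2 s2 :
  0 < s1 -> 0 < s2 -> measurable_fun setT m -> measurable_fun setT x ->
  measurable_fun setT (fun z => normal_lr (m z) s1 m2 s2 (x z)).
Proof.
move=> s10 s20 mm mx; under eq_fun do rewrite normal_lr_expR//.
apply: measurable_funM => //; apply: measurableT_comp => //.
apply: measurable_funB; apply: measurable_funM => //; apply: measurable_funX;
  exact: measurable_funB.
Qed.

Lemma normal_prob_density m1 s1 m2 s2 (A : set (measurableTypeR R)) :
  0 < s1 -> 0 < s2 -> measurable A ->
  (normal_prob m1 s1 A =
   \int[normal_prob m2 s2]_(x in A) (normal_lr m1 s1 m2 s2 x)%:E)%E.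
Proof.
move=> s10 s20 mA; rewrite integral_normal_prob//; last 2 first.
- exact: measurable_normal_lr (measurable_cst _) _.
- by move=> x; exact: normal_lr_ge0.
apply: eq_integral => x _; congr EFin.
by rewrite /normal_lr divfK// gt_eqF// normal_pdf_gt0.
Qed.

(** Bayes' rule in one coordinate: multiplied by the N(0, tau^2) density at [t] and the N(0, rho^2)
    density at [y], both sides become the joint density of parameter and observation. *)
Lemma normal_lr_conjugate sigma tau rho t y :
  0 < sigma -> 0 < tau -> 0 < rho -> rho ^+ 2 = sigma ^+ 2 + tau ^+ 2 ->
  normal_lr t sigma 0 rho y =
  normal_lr (tau ^+ 2 / rho ^+ 2 * y) (sigma * tau / rho) 0 tau t.
Proof.
move=> s0 t0 r0 rE.
have str0 : 0 < sigma * tau / rho by rewrite divr_gt0// mulr_gt0.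
rewrite !normal_lr_expR//; congr (_ * expR _).
  by field; rewrite !gt_eqF//.
have -> : tau ^+ 2 = rho ^+ 2 - sigma ^+ 2 by rewrite rE; ring.
rewrite !exprMn exprVn.
have -> : tau ^+ 2 = rho ^+ 2 - sigma ^+ 2 by rewrite rE; ring.
have : rho ^+ 2 - sigma ^+ 2 != 0.
  by rewrite rE addrAC subrr add0r gt_eqF// exprn_gt0.
move=> h; field; rewrite h !gt_eqF//.
Qed.

(** Squaring the ratio doubles the precision of the first law and leaves minus that of the second: 2
    / s1^2 - 1 / sigma^2 = 1 / s3^2. Completing the square then gives the mean (1 - b) / (1 + b) *
    y. *)
Lemma normal_lr_sqr_pdf sigma s1 s3 b y x :
  0 < sigma -> 0 < s1 -> 0 < s3 -> 0 <= b < 1 ->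
  s1 ^+ 2 = (1 - b) * sigma ^+ 2 ->
  s3 ^+ 2 = (1 - b) / (1 + b) * sigma ^+ 2 ->
  normal_lr ((1 - b) * y) s1 y sigma x ^+ 2 * normal_pdf y sigma x =
  sigma * s3 / s1 ^+ 2 * expR (b ^+ 2 * y ^+ 2 / ((1 + b) * sigma ^+ 2)) *
  normal_pdf ((1 - b) / (1 + b) * y) s3 x.
Proof.
move=> s0 s10 s30 /andP[b0 b1] s1E s3E.
rewrite normal_lr_expR// !normal_pdf_expR// exprMn -expRM_natl.
have hb : 1 - b != 0 by rewrite gt_eqF//; lra.
have hb' : 1 + b != 0 by rewrite gt_eqF//; lra.
rewrite mulrACA -expRD [RHS]mulrACA -expRD; congr (_ * expR _).
  have := sqrt_2pi_gt0; set a := Num.sqrt _ => a0.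
  by field; rewrite !gt_eqF//.
by rewrite s1E s3E; field; rewrite hb hb' gt_eqF.
Qed.

Lemma normal_chi2_le sigma s1 b y :
  0 < sigma -> 0 < s1 -> 0 <= b -> b ^+ 2 <= 2^-1 ->
  s1 ^+ 2 = (1 - b) * sigma ^+ 2 ->
  (\int[normal_prob y sigma]_x (normal_lr ((1 - b) * y) s1 y sigma x ^+ 2)%:E
   <= (expR (b ^+ 2 + b ^+ 2 * y ^+ 2 / sigma ^+ 2))%:E)%E.
Proof.
move=> s0 s10 b0 b2 s1E.
have b1 : b < 1 by rewrite ltNge; apply/negP => b1; nra.
pose s3 := Num.sqrt ((1 - b) / (1 + b)) * sigma.
have q0 : 0 < (1 - b) / (1 + b) by rewrite divr_gt0//; lra.
have s30 : 0 < s3 by rewrite mulr_gt0// sqrtr_gt0.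
have s3E : s3 ^+ 2 = (1 - b) / (1 + b) * sigma ^+ 2.
  by rewrite exprMn sqr_sqrtr// ltW.
clearbody s3.
rewrite integral_normal_prob//; last 2 first.
- by apply: measurable_funX; exact: measurable_normal_lr (measurable_cst _) _.
- by move=> x; exact: sqr_ge0.
under eq_integral => x _.
  rewrite (@normal_lr_sqr_pdf _ _ s3)//; last by rewrite b0.
  rewrite EFinM; over.
rewrite ge0_integralZl//; last 3 first.
- by apply/measurable_EFinP; exact: measurable_normal_pdf.
- by move=> x _; rewrite lee_fin normal_pdf_ge0.
- by rewrite lee_fin mulr_ge0 ?expR_ge0// divr_ge0 ?sqr_ge0// mulr_ge0// ltW.
rewrite integral_normal_pdf mule1 lee_fin expRD ler_pM ?expR_ge0//.
- by rewrite divr_ge0 ?sqr_ge0// mulr_ge0// ltW.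
(* The squared prefactor is 1 / (1 - b^2), and (1 + 2 b^2) (1 - b^2) >= 1 exactly when b^2 <= 1/2:
   this is the origin of that hypothesis. *)
- rewrite -ler_sqr ?nnegrE ?expR_ge0//; last first.
    by rewrite divr_ge0 ?sqr_ge0// mulr_ge0// ltW.
  rewrite !exprMn exprVn s3E s1E -expRM_natl.
  apply: le_trans (expR_ge1Dx _).
  have -> : sigma ^+ 2 * ((1 - b) / (1 + b) * sigma ^+ 2) *
      (((1 - b) * sigma ^+ 2) ^+ 2)^-1 = (1 - b ^+ 2)^-1.
    by field; rewrite !gt_eqF//; nra.
  by rewrite -[leLHS]mul1r ler_pdivrMr; nra.
- rewrite ler_expR; apply: ler_wpM2l; first by rewrite mulr_ge0 ?sqr_ge0.
  rewrite lef_pV2 ?posrE ?mulr_gt0 ?exprn_gt0//; last lra.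
  by rewrite ler_peMl ?sqr_ge0//; lra.
Qed.

End normal.

Section affine.
Context (R : realType) (m s : R).
Hypothesis s0 : 0 < s.
Local Notation mu := (@lebesgue_measure R).

Let phi (x : measurableTypeR R) : measurableTypeR R := m + s * x.

Let mphi : measurable_fun setT phi.
Proof. by apply: measurable_funD => //; exact: measurable_funM. Qed.

HB.instance Definition _ := isMeasurableFun.Build _ _ _ _ phi mphi.

(** Lebesgue measure is determined by half-open intervals, whose lengths [phi] multiplies by [s]. *)
Let lebesgue_measure_affine (A : set (measurableTypeR R)) : measurable A ->
  (mu A = s%:E * pushforward mu phi A)%E.
Proof.
have s00 : 0 <= s by exact: ltW.
apply: (@lebesgue_measure_unique _ (mscale (NngNum s00) (pushforward mu phi))).
move=> _ [[a b]] _ <- /=; rewrite /mscale/= /pushforward.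
rewrite (_ : phi @^-1` _ = `](a - m) / s, (b - m) / s]%classic); last first.
  apply/seteqP; split => x /=; rewrite !in_itv/= ltr_pdivrMr// ler_pdivlMr//;
    by rewrite ltrBlDl lerBrDl mulrC.
rewrite !lebesgue_measure_itv/= !lte_fin ltr_pM2r ?invr_gt0// ltrD2r.
case: ifPn => _; last by rewrite mule0.
by rewrite -!EFinD -EFinM; congr EFin; field; rewrite gt_eqF.
Qed.

Lemma normal_prob_affine (A : set (measurableTypeR R)) : measurable A ->
  normal_prob m s A = normal_prob 0 1 ((fun x => m + s * x) @^-1` A).
Proof.
move=> mA; rewrite /normal_prob.
have s00 : 0 <= s by exact: ltW.
have mpdf : measurable_fun A (EFin \o normal_pdf m s).
  by apply: measurable_funTS; apply/measurable_EFinP; exact: measurable_normal_pdf.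
have pdf0 x : (0 <= (normal_pdf m s x)%:E)%E by rewrite lee_fin normal_pdf_ge0.
have mphiA : measurable (phi @^-1` A) by rewrite -[X in measurable X]setTI; exact: mphi.
rewrite (eq_measure_integral (mscale (NngNum s00) (pushforward mu phi))); last first.
  by move=> B mB _; exact: lebesgue_measure_affine.
rewrite ge0_integral_mscale//= ge0_integral_pushforward//.
rewrite -ge0_integralZl//; last 2 first.
- apply: measurable_funTS; apply: measurableT_comp mphi.
  by apply/measurable_EFinP; exact: measurable_normal_pdf.
- by move=> x _; exact: pdf0.
apply: eq_integral => x _ /=; rewrite -EFinM; congr EFin.
rewrite !normal_pdf_expR// /phi.
have := @sqrt_2pi_gt0 R; set c := Num.sqrt _ => c0.
rewrite !mulrA; congr (_ * expR _); first by field; rewrite !gt_eqF.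
by field; rewrite gt_eqF.
Qed.

Lemma integral_normal_affine (f : R -> R) :
  measurable_fun setT f -> (forall x, 0 <= f x) ->
  (\int[normal_prob m s]_x (f x)%:E = \int[normal_prob 0 1]_x (f (m + s * x))%:E)%E.
Proof.
move=> mf f0.
rewrite (eq_measure_integral (pushforward (normal_prob 0 1) phi)); last first.
  by move=> B mB _; exact: normal_prob_affine.
rewrite ge0_integral_pushforward//.
  exact/measurable_EFinP.
by move=> x _; rewrite lee_fin.
Qed.

End affine.

(** An upper bound for the second moment of N(0, 1), not its value 1; any finite constant serves the
    limits. *)
Definition normal_moment2 (R : realType) : R := 4 * Num.sqrt 2.

Section moments.
Context (R : realType).

Lemma normal_moment2_ge0 : 0 <= normal_moment2 R.
Proof. by rewrite mulr_ge0. Qed.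

(* [x ^ 2 <= 4 exp (x ^ 2 / 4)], and [exp (x ^ 2 / 4)] turns the standard
   density into [sqrt 2] times the density of N(0, 2). *)
Lemma normal_moment2_le :
  (\int[normal_prob 0 1]_x (x ^+ 2)%:E <= (normal_moment2 R)%:E)%E.
Proof.
have s20 : 0 < Num.sqrt 2 :> R by rewrite sqrtr_gt0.
rewrite integral_normal_prob//; last by move=> x; exact: sqr_ge0.
rewrite -[leRHS]mule1 -(integral_normal_pdf 0 (Num.sqrt 2 : R)) -ge0_integralZl//; last 3 first.
- by apply/measurable_EFinP; exact: measurable_normal_pdf.
- by move=> x _; rewrite lee_fin normal_pdf_ge0.
- by rewrite lee_fin normal_moment2_ge0.
apply: ge0_le_integral => //.
- by move=> x _; rewrite lee_fin mulr_ge0 ?sqr_ge0 ?normal_pdf_ge0.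
- apply/measurable_EFinP/measurable_funM; first exact: measurable_funX.
  exact: measurable_normal_pdf.
- by apply: emeasurable_funM => //; apply/measurable_EFinP; exact: measurable_normal_pdf.
move=> x _; rewrite -EFinM lee_fin !normal_pdf_expR// subr0 sqr_sqrtr//.
have -> : - (x ^+ 2 / (2 * 1 ^+ 2)) = - (x ^+ 2 / (2 * 2)) - x ^+ 2 / 4 :> R by field.
rewrite expRD [expR (- (x ^+ 2 / 4))]expRN.
have := expR_ge1Dx (x ^+ 2 / 4); have := expR_gt0 (- (x ^+ 2 / (2 * 2))).
have := @sqrt_2pi_gt0 R.
rewrite /normal_moment2; set c := Num.sqrt (pi *+ 2); set e := expR _.
set e4 := expR _ => c0 e0 he.
have e40 : 0 < e4 by exact: expR_gt0.
have -> : 4 * Num.sqrt 2 * (c^-1 / Num.sqrt 2 * e) = 4 * e / c.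
  by field; rewrite !gt_eqF.
have -> : x ^+ 2 * (c^-1 / 1 * (e / e4)) = (x ^+ 2 / e4) * e / c.
  by field; rewrite !gt_eqF.
rewrite ler_pM2r ?invr_gt0// ler_pM2r// ler_pdivrMr//.
lra.
Qed.

End moments.

(** * Gaussian vectors *)

Section gaussian_vectors.
Context (R : realType) (k : nat).
Implicit Types (m x y c : Rvec R k) (A : set (Rvec R k)).

Lemma measurable_tnthR d (T : measurableType d) (f : T -> Rvec R k) (i : 'I_k) :
  measurable_fun setT f -> measurable_fun setT (fun z => tnth (f z) i : R).
Proof.
move=> mf; apply: (measurableT_comp (f := fun x : Rvec R k => tnth x i)) => //.
exact: measurable_tnth.
Qed.

Lemma gaussian_density m1 s1 m2 s2 A : 0 < s1 -> 0 < s2 -> measurable A ->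
  (gaussian m1 s1 A = \int[gaussian m2 s2]_(x in A)
    (\prod_(i < k) normal_lr (tnth m1 i) s1 (tnth m2 i) s2 (tnth x i))%:E)%E.
Proof.
move=> s10 s20 mA; rewrite /gaussian.
apply: (@prod_prob_density _ (measurableTypeR R) R k
  (fun i => normal_prob (tnth m1 i) s1) (fun i => normal_prob (tnth m2 i) s2)
  (fun i => normal_lr (tnth m1 i) s1 (tnth m2 i) s2)) => //.
- by move=> i; exact: measurable_normal_lr (measurable_cst _) _.
- by move=> i x; exact: normal_lr_ge0.
- by move=> i B mB; exact: normal_prob_density.
Qed.

Lemma integral_gaussian_prod m (s : R) (f : 'I_k -> R -> R) :
  (forall i, measurable_fun setT (f i)) -> (forall i u, 0 <= f i u) ->
  (\int[gaussian m s]_x (\prod_(i < k) f i (tnth x i))%:E =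
   \prod_(i < k) \int[normal_prob (tnth m i) s]_u (f i u)%:E)%E.
Proof.
exact: (@integral_prod_prob _ (measurableTypeR R) R k
  (fun i => normal_prob (tnth m i) s) f).
Qed.

Lemma gaussian_ae m1 s1 m2 s2 (Q : Rvec R k -> Prop) : 0 < s1 -> 0 < s2 ->
  {ae gaussian m2 s2, forall x, Q x} -> {ae gaussian m1 s1, forall x, Q x}.
Proof.
move=> s10 s20 [N [mN N0 QN]]; exists N; split => //.
transitivity (gaussian m1 s1 N) => //.
rewrite (gaussian_density _ m2 _ s20)//; apply: null_set_integral => //.
apply: measurable_funTS; apply/measurable_EFinP.
apply: (measurable_prod_tnth (f := fun i => normal_lr (tnth m1 i) s1 (tnth m2 i) s2)) => i.
exact: measurable_normal_lr (measurable_cst _) _.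
Qed.

Lemma gaussian_posterior (sigma tau rho : R) (kappa : R.-pker (Rvec R k) ~> (Rvec R k)) :
  0 < sigma -> 0 < tau -> 0 < rho -> rho ^+ 2 = sigma ^+ 2 + tau ^+ 2 ->
  is_posterior (gaussian (zerov R k) tau) (fun t => gaussian t sigma) kappa ->
  {ae gaussian (zerov R k) rho, forall y A, measurable A ->
    kappa y A = gaussian [tuple (tau ^+ 2 / rho ^+ 2 * tnth y i)%R | i < k]
                         (sigma * tau / rho) A}.
Proof.
move=> s0 t0 r0 rE kappaP.
(* Defined as the density of the data given the parameter; by [normal_lr_conjugate] it is also the
   density of the posterior against the prior. *)
pose r (z : Rvec R k * Rvec R k) : R :=
  \prod_(i < k) normal_lr (tnth z.1 i) sigma 0 rho (tnth z.2 i).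
apply: (posterior_ae_eq (r := r) _ _ _ _ kappaP).
- apply: measurable_prod => i _; apply: measurable_normal_lr => //;
    by apply: measurable_tnthR.
- by move=> z; apply: prodr_ge0 => i _; exact: normal_lr_ge0.
- move=> t B mB; rewrite (gaussian_density _ (zerov R k) _ r0)//.
  by apply: eq_integral => y _; under eq_bigr do rewrite tnth_mktuple.
- move=> y B mB; rewrite (gaussian_density _ (zerov R k) _ t0)//; last first.
    by rewrite divr_gt0// mulr_gt0.
  apply: eq_integral => t _; congr EFin; apply: eq_bigr => i _.
  by rewrite !tnth_mktuple (normal_lr_conjugate _ _ s0 t0 r0 rE).
Qed.

(* With [x] the exponent of the chi-square bound: [expR x - 1 <= 2 x] if
   [x <= 1 / 2], and otherwise [x / t >= 1] makes the claim trivial. *)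
Lemma gaussian_tv_le (sigma s1 b t : R) y A :
  0 < sigma -> 0 < s1 -> 0 <= b -> b ^+ 2 <= 2^-1 ->
  s1 ^+ 2 = (1 - b) * sigma ^+ 2 -> 0 < t <= 2^-1 -> measurable A ->
  (`|gaussian [tuple ((1 - b) * tnth y i)%R | i < k] s1 A - gaussian y sigma A|
   <= (t / 2 + (k%:R * b ^+ 2 +
        b ^+ 2 / sigma ^+ 2 * \sum_(i < k) (tnth y i : R) ^+ 2) / t)%:E)%E.
Proof.
move=> s0 s10 b0 b2 s1E /andP[t0 t1] mA.
set x := (X in X / t).
have x0 : 0 <= x.
  rewrite addr_ge0// mulr_ge0 ?sqr_ge0 ?divr_ge0 ?sqr_ge0//.
  by rewrite sumr_ge0// => i _; exact: sqr_ge0.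
have [x1|x1] := leP x 2^-1; last first.
  apply: le_trans (abse_prob_sub_le1 _ _ mA) _; rewrite lee_fin.
  have : 1 <= x / t by rewrite ler_pdivlMr//; lra.
  lra.
pose f (z : Rvec R k) : R :=
  \prod_(i < k) normal_lr ((1 - b) * tnth y i) s1 (tnth y i) sigma (tnth z i).
apply: (@le_trans _ _ (t / 2 + (expR x - 1) / (2 * t))%:E).
  apply: (@abse_prob_sub_le _ _ _ _ _ f) => //.
  - apply: (measurable_prod_tnth
      (f := fun i => normal_lr ((1 - b) * tnth y i) s1 (tnth y i) sigma)) => i.
    exact: measurable_normal_lr (measurable_cst _) _.
  - by move=> z; apply: prodr_ge0 => i _; exact: normal_lr_ge0.
  - move=> B mB; rewrite (gaussian_density _ y _ s0)//.
    by apply: eq_integral => z _; under eq_bigr do rewrite tnth_mktuple.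
  under eq_integral do rewrite /f -prodrXl.
  rewrite (@integral_gaussian_prod _ _ (fun i u =>
    normal_lr ((1 - b) * tnth y i) s1 (tnth y i) sigma u ^+ 2)); last 2 first.
  - move=> i; apply: measurable_funX.
    exact: measurable_normal_lr (measurable_cst _) _.
  - by move=> i u; exact: sqr_ge0.
  rewrite (_ : expR x = \prod_(i < k)
      expR (b ^+ 2 + b ^+ 2 * (tnth y i : R) ^+ 2 / sigma ^+ 2)); last first.
    rewrite -expR_sum big_split/= sumr_const card_ord; congr expR.
    rewrite /x mulr_natl mulr_sumr; congr (_ + _).
    by apply: eq_bigr => i _; rewrite mulrAC.
  rewrite -prodEFin.
  (* Nonnegativity is carried along because factorwise bounds multiply only for nonnegative
     factors. *)
  suff /andP[] : (0 <= \prod_(i < k) \int[normal_prob (tnth y i) sigma]_u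
      (normal_lr ((1 - b) * tnth y i) s1 (tnth y i) sigma u ^+ 2)%:E <=
      \prod_(i < k) (expR (b ^+ 2 + b ^+ 2 * (tnth y i : R) ^+ 2 / sigma ^+ 2))%:E)%E by [].
  apply: (big_ind2 (fun u v => 0 <= u <= v)%E); first by rewrite lee01 lexx.
    move=> u1 v1 u2 v2 /andP[u10 uv1] /andP[u20 uv2].
    by rewrite mule_ge0// lee_pmul.
  move=> i _; rewrite normal_chi2_le// andbT.
  by apply: integral_ge0 => u _; rewrite lee_fin sqr_ge0.
rewrite lee_fin lerD2l.
(* From expR (- x) >= 1 - x one gets (1 - x) * expR x <= 1, and (1 - x) (1 + 2 x) >= 1 for 0 <= x <=
   1/2. *)
have ex : expR x <= 1 + 2 * x.
  have := expR_ge1Dx (- x); rewrite expRN => h.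
  have e0 := expR_gt0 x.
  have : (1 - x) * expR x <= 1 by rewrite -ler_pdivlMr// mul1r.
  nra.
rewrite invfM mulrA ler_pM2r ?invr_gt0// ler_pdivrMr//; lra.
Qed.

Lemma integral_gaussian_sum (s : R) m (f : 'I_k -> R -> R) :
  (forall i, measurable_fun setT (f i)) -> (forall i u, 0 <= f i u) ->
  (\int[gaussian m s]_x (\sum_(i < k) f i (tnth x i))%:E =
   \sum_(i < k) \int[normal_prob (tnth m i) s]_u (f i u)%:E)%E.
Proof.
move=> mf f0; under eq_integral do rewrite -sumEFin.
rewrite ge0_integral_sum//; last 2 first.
- move=> i; apply/measurable_EFinP.
  exact: (measurableT_comp (mf i) (measurable_tnth i)).
- by move=> i x _; rewrite lee_fin.
apply: eq_bigr => i _.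
(* A function of one coordinate is a product whose other factors are 1, so the product formula
   applies to each summand. *)
pose g j : R -> R := if j == i then f i else cst 1.
transitivity (\int[gaussian m s]_x (\prod_(j < k) g j (tnth x j))%:E)%E.
  apply: eq_integral => x _; rewrite (bigD1 i)//= {1}/g eqxx big1 ?mulr1//.
  by move=> j ji; rewrite /g (negbTE ji).
rewrite integral_gaussian_prod.
- rewrite (bigD1 i)//= {1}/g eqxx big1 ?mule1// => j ji.
  transitivity (\int[normal_prob (tnth m j) s]_u cst 1%E u)%E.
    by apply: eq_integral => u _; rewrite /g (negbTE ji).
  by rewrite integral_cst// mul1e; exact: probability_setT.
- by move=> j; rewrite /g; case: ifP.
- by move=> j u; rewrite /g; case: ifP.
Qed.

Lemma normal_sqr_dist_le (a c s : R) : 0 < s ->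
  (\int[normal_prob a s]_u ((u - c) ^+ 2)%:E <=
   (2 * (a - c) ^+ 2 + 2 * s ^+ 2 * normal_moment2 R)%:E)%E.
Proof.
move=> s0.
have mx : measurable_fun setT (fun x : R => x ^+ 2) by exact: measurable_funX.
rewrite integral_normal_affine//; last 2 first.
- by apply: measurable_funX; exact: measurable_funB.
- by move=> x; exact: sqr_ge0.
apply: (@le_trans _ _ (\int[normal_prob 0 1]_x
    ((2 * (a - c) ^+ 2)%:E + (2 * s ^+ 2)%:E * (x ^+ 2)%:E))%E).
  apply: ge0_le_integral => //.
  - by move=> x _; rewrite lee_fin sqr_ge0.
  - apply/measurable_EFinP/measurable_funX; apply: measurable_funB => //.
    by apply: measurable_funD => //; exact: measurable_funM.
  - apply: emeasurable_funD => //; apply: emeasurable_funM => //.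
    exact/measurable_EFinP.
  - move=> x _; rewrite -EFinM -EFinD lee_fin.
    (* (u + v)^2 <= 2 u^2 + 2 v^2 removes the cross term, so no first moment has to be computed. *)
    have := sqr_ge0 (a - c - s * x); nra.
rewrite ge0_integralD//; last 3 first.
- by move=> x _; rewrite lee_fin mulr_ge0 ?sqr_ge0.
- by move=> x _; rewrite -EFinM lee_fin mulr_ge0 ?sqr_ge0// mulr_ge0 ?sqr_ge0.
- by apply: emeasurable_funM => //; exact/measurable_EFinP.
rewrite ge0_integralZl//; last 3 first.
- exact/measurable_EFinP.
- by move=> x _; rewrite lee_fin sqr_ge0.
- by rewrite lee_fin mulr_ge0 ?sqr_ge0.
rewrite integral_cst// [X in (_ * X + _)%E](_ : _ = 1%E); last exact: probability_setT.
rewrite mule1 EFinD leeD2l// [leRHS]EFinM lee_wpmul2l//.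
  by rewrite lee_fin mulr_ge0 ?sqr_ge0.
exact: normal_moment2_le.
Qed.

Lemma measurable_enorm_ge (r : R) c :
  measurable [set x : Rvec R k | r <= enorm (vsub x c)].
Proof.
have me : measurable_fun setT (fun x : Rvec R k => enorm (vsub x c)).
  apply: (measurableT_comp (f := @Num.sqrt R)
    (g := fun x : Rvec R k => \sum_(i < k) (tnth (vsub x c) i : R) ^+ 2)).
    exact: (continuous_measurable_fun (@sqrt_continuous R)).
  apply: measurable_sum => i; apply: measurable_funX.
  under eq_fun do rewrite tnth_mktuple.
  by apply: measurable_funB => //; exact: measurable_tnth.
rewrite -[X in measurable X]setTI.
rewrite (_ : [set x | _] = (fun x => enorm (vsub x c)) @^-1` `[r, +oo[); last first.
  by apply/seteqP; split => x /=; rewrite in_itv/= andbT.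
exact: me.
Qed.

(** Markov's inequality for the squared norm. The centre [c] differs from the mean because the law
    centred at Y is tested around theta_0; the first sum then becomes the noise energy. *)
Lemma gaussian_tail_le (r s : R) y c : 0 < r -> 0 < s ->
  (gaussian y s [set x | (r <= enorm (vsub x c))%R] <=
   ((2 * \sum_(i < k) (tnth y i - tnth c i : R) ^+ 2 +
     k%:R * (2 * s ^+ 2 * normal_moment2 R)) / r ^+ 2)%:E)%E.
Proof.
move=> r0 s0; set A := [set x | _].
have mA : measurable A by exact: measurable_enorm_ge.
rewrite -[leLHS]mul1e -[leLHS]integral_cst//.
pose f (i : 'I_k) (u : R) := (u - tnth c i) ^+ 2 / r ^+ 2.
have mf i : measurable_fun setT (f i).
  by apply: measurable_funM => //; apply: measurable_funX; exact: measurable_funB.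
have f0 i u : 0 <= f i u by rewrite divr_ge0 ?sqr_ge0.
have mF : measurable_fun setT (fun x : Rvec R k => (\sum_(i < k) f i (tnth x i))%:E).
  apply/measurable_EFinP/measurable_sum => i.
  exact: (measurableT_comp (mf i) (measurable_tnth i)).
have F0 (x : Rvec R k) : (0 <= (\sum_(i < k) f i (tnth x i))%:E)%E.
  by rewrite lee_fin sumr_ge0.
apply: (@le_trans _ _ (\int[gaussian y s]_x (\sum_(i < k) f i (tnth x i))%:E)%E).
  apply: (@le_trans _ _ (\int[gaussian y s]_(x in A) (\sum_(i < k) f i (tnth x i))%:E)%E).
    apply: ge0_le_integral => //; first exact: measurable_funTS.
    move=> x; rewrite /A/= lee_fin -mulr_suml ler_pdivlMr ?exprn_gt0// mul1r.
    rewrite -ler_sqr ?nnegrE ?sqrtr_ge0 ?(ltW r0)// sqr_sqrtr.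
      by move=> /le_trans; apply; under eq_bigr do rewrite tnth_mktuple.
    by rewrite sumr_ge0// => i _; exact: sqr_ge0.
  exact: ge0_subset_integral.
rewrite integral_gaussian_sum//.
apply: (@le_trans _ _ (\sum_(i < k) ((2 * (tnth y i - tnth c i) ^+ 2 +
    2 * s ^+ 2 * normal_moment2 R) / r ^+ 2)%:E)%E).
  apply: lee_sum => i _; rewrite /f.
  under eq_integral do rewrite mulrC EFinM.
  rewrite ge0_integralZl//; last 3 first.
  - apply/measurable_EFinP; apply: measurable_funX; exact: measurable_funB.
  - by move=> x _; rewrite lee_fin sqr_ge0.
  - by rewrite lee_fin invr_ge0 sqr_ge0.
  rewrite [X in (_ <= X%:E)%E]mulrC EFinM lee_wpmul2l//.
    by rewrite lee_fin invr_ge0 sqr_ge0.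
  exact: normal_sqr_dist_le.
rewrite sumEFin lee_fin -mulr_suml big_split/= -mulr_sumr sumr_const card_ord.
by rewrite (mulr_natl _ k).
Qed.

End gaussian_vectors.

(** * The sequence model *)

Section sequence_model.
Context d (Omega : measurableType d) (R : realType) (P : probability Omega R).
Variables (xi : nat -> {RV P >-> R}) (theta0 : nat -> nat -> R) (k : nat -> nat).
Hypothesis hxi : iid_standard_normal xi.
Variable n : nat.
Hypothesis n0 : (0 < n)%N.
Local Notation sigma := ((Num.sqrt n%:R)^-1 : R).
Local Notation Y := (theta_Y theta0 xi k n).
Local Notation V := (normal_moment2 R).

Lemma noise_sd_gt0 : 0 < sigma.
Proof. by rewrite invr_gt0 sqrtr_gt0 ltr0n. Qed.

Lemma noise_sd_sqr : sigma ^+ 2 = n%:R^-1.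
Proof. by rewrite exprVn sqr_sqrtr. Qed.

Lemma measurable_theta_Y : measurable_fun setT (Y : Omega -> Rvec R (k n)).
Proof.
apply/measurable_fun_tnthP => i.
rewrite (_ : _ \o _ = fun w => theta0 n i + sigma * xi i w); last first.
  by apply/funext => w /=; rewrite tnth_mktuple.
by apply: measurable_funD => //; exact: measurable_funM.
Qed.

Lemma theta_Y_law (A : set (Rvec R (k n))) : measurable A ->
  P (Y @^-1` A) = gaussian (proj_true theta0 k n) sigma A.
Proof.
pose mixY := isMeasurableFun.Build _ _ _ _ _ measurable_theta_Y.
pose X : {mfun Omega >-> Rvec R (k n)} := HB.pack (Y : Omega -> Rvec R (k n)) mixY.
apply: (@eq_prod_prob_boxes _ (measurableTypeR R) R (k n)
  (fun i => normal_prob (tnth (proj_true theta0 k n) i) sigma)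
  (distribution P X)) => B mB.
(* Independence is stated for families indexed by all of [nat], so the sides of the box are extended
   by [setT] and pulled back to the noise variables. *)
pose C (j : nat) : set R := (fun x => theta0 n j + sigma * x) @^-1`
  (if insub j is Some i then B i else setT).
have mC j : measurable (C j).
  rewrite /C -[X in measurable X]setTI.
  have mf : measurable_fun setT (fun x : R => theta0 n j + sigma * x).
    by apply: measurable_funD => //; exact: measurable_funM.
  by apply: mf => //; case: insub.
have CE (i : 'I_(k n)) : C i = (fun x => theta0 n i + sigma * x) @^-1` B i.
  by rewrite /C valK.
transitivity (P (\bigcap_(j in [set` index_iota 0 (k n)]) xi j @^-1` C j)).
  rewrite /= /distribution /pushforward; congr (P _).
  apply/seteqP; split => w /=.
    move=> wB j /=; rewrite mem_index_iota => /= jk.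
    have := wB (Ordinal jk); rewrite tnth_mktuple /=.
    by rewrite -[j]/(val (Ordinal jk)) CE.
  move=> wC i; have := wC i; rewrite /= mem_index_iota ltn_ord => /(_ isT).
  by rewrite CE/= tnth_mktuple.
rewrite hxi.1//; last exact: iota_uniq.
rewrite big_mkord; apply: eq_bigr => i _.
transitivity (distribution P (xi i) (C i)) => //.
by rewrite hxi.2// CE tnth_mktuple [RHS]normal_prob_affine//; exact: noise_sd_gt0.
Qed.

Lemma theta_Y_ae (m : Rvec R (k n)) (s : R) (Q : Rvec R (k n) -> Prop) : 0 < s ->
  {ae gaussian m s, forall y, Q y} -> {ae P, forall w, Q (Y w)}.
Proof.
move=> s0 /(gaussian_ae (proj_true theta0 k n) noise_sd_gt0 s0)[N [mN N0 QN]].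
exists (Y @^-1` N); split.
- rewrite -[X in measurable X]setTI; exact: measurable_theta_Y.
- by rewrite -N0; exact: theta_Y_law.
- by move=> w /= Qw; exact: QN.
Qed.

(** This is the squared norm of Y - theta_0 in the first [k n] coordinates, the only random quantity
    kept in the bounds. *)
Definition noise_energy w := \sum_(j < k n) (sigma * xi j w) ^+ 2.

Lemma noise_energy_ge0 w : 0 <= noise_energy w.
Proof. by rewrite sumr_ge0// => j _; exact: sqr_ge0. Qed.

Lemma measurable_noise_energy : measurable_fun setT noise_energy.
Proof.
by apply: measurable_sum => j; apply: measurable_funX; exact: measurable_funM.
Qed.

Lemma integral_noise_energy_le :
  (\int[P]_w (noise_energy w)%:E <= ((k n)%:R * sigma ^+ 2 * V)%:E)%E.
Proof.
under eq_integral do rewrite -sumEFin.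
rewrite ge0_integral_sum//; last 2 first.
- by move=> j; apply/measurable_EFinP/measurable_funX; exact: measurable_funM.
- by move=> j w _; rewrite lee_fin sqr_ge0.
apply: (@le_trans _ _ (\sum_(j < k n) (sigma ^+ 2 * V)%:E)%E).
  apply: lee_sum => j _; under eq_integral do rewrite exprMn EFinM.
  rewrite ge0_integralZl//; last 2 first.
  - by apply/measurable_EFinP; exact: measurable_funX.
  - by move=> w _; rewrite lee_fin sqr_ge0.
  rewrite [leRHS]EFinM lee_wpmul2l//.
  (* [R] and [measurableTypeR R] carry the same measurable sets under different
     displays. *)
  have mxi : measurable_fun setT (xi j : Omega -> measurableTypeR R).
    have h : measurable_fun setT (xi j : Omega -> R) by [].
    by move=> _ A mA; exact: h measurableT A mA.
  pose X : {mfun Omega >-> measurableTypeR R} :=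
    HB.pack (xi j : Omega -> measurableTypeR R) (isMeasurableFun.Build _ _ _ _ _ mxi).
  have := @ge0_integral_distribution _ _ _ (measurableTypeR R) R P X
    (fun x => (x ^+ 2)%:E).
  move=> /= <-; last 2 first.
  - by apply/measurable_EFinP; exact: measurable_funX.
  - by move=> x; rewrite lee_fin sqr_ge0.
  rewrite (eq_measure_integral (normal_prob 0 1)); last by move=> A mA _; exact: hxi.2.
  exact: normal_moment2_le.
by rewrite sumEFin sumr_const card_ord -mulrA mulr_natl.
Qed.

Lemma integral_le_noise_energy (f : Omega -> \bar R) (a b : R) :
  (forall w, 0 <= f w)%E -> 0 <= a -> 0 <= b ->
  {ae P, forall w, (f w <= (a + b * noise_energy w)%:E)%E} ->
  (\int[P]_w f w <= (a + b * ((k n)%:R * sigma ^+ 2 * V))%:E)%E.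
Proof.
move=> f0 a0 b0 fle.
have mq := measurable_noise_energy.
apply: (@le_trans _ _ (\int[P]_w (a%:E + b%:E * (noise_energy w)%:E))%E).
  apply: le_ge0_integral_ae => //.
  - move=> w; rewrite -EFinM -EFinD lee_fin addr_ge0// mulr_ge0//.
    exact: noise_energy_ge0.
  - by apply: emeasurable_funD => //; apply: emeasurable_funM => //; exact/measurable_EFinP.
rewrite ge0_integralD//; last 2 first.
- by move=> w _; rewrite -EFinM lee_fin mulr_ge0// noise_energy_ge0.
- by apply: emeasurable_funM => //; exact/measurable_EFinP.
rewrite ge0_integralZl//; last 2 first.
- exact/measurable_EFinP.
- by move=> w _; rewrite lee_fin noise_energy_ge0.
rewrite integral_cst// [X in (_ * X + _)%E](_ : _ = 1%E); last exact: probability_setT.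
by rewrite mule1 EFinD leeD2l// [leRHS]EFinM lee_wpmul2l// integral_noise_energy_le.
Qed.

Variables (tau M : R) (post : R.-pker (Rvec R (k n)) ~> (Rvec R (k n))).
Hypotheses (tau0 : 0 < tau) (kn : (1 <= k n <= n)%N).
Hypothesis postP : is_posterior (gaussian (zerov R (k n)) tau)
  (fun theta => gaussian theta sigma) post.
Hypothesis energyM : \sum_(j < k n) theta0 n j ^+ 2 <= M.

Definition shrinkage := sigma ^+ 2 / (sigma ^+ 2 + tau ^+ 2).
Local Notation b := shrinkage.

Let M0 : 0 <= M.
Proof. by apply: le_trans energyM; rewrite sumr_ge0// => j _; exact: sqr_ge0. Qed.

Lemma theta_Y_energy_le w :
  \sum_(i < k n) (tnth (Y w) i : R) ^+ 2 <= 2 * M + 2 * noise_energy w.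
Proof.
apply: (@le_trans _ _ (\sum_(i < k n) (2 * theta0 n i ^+ 2 + 2 * (sigma * xi i w) ^+ 2))).
  apply: ler_sum => i _; rewrite tnth_mktuple /observation.
  have := sqr_ge0 (theta0 n i - sigma * xi i w); nra.
by rewrite big_split/= -!mulr_sumr lerD2r ler_pM2l.
Qed.

(** The quantifier over [A] stands inside the almost sure event, so the same event serves the
    supremum in [tv_dist] and the tail set of the contraction rate. *)
Lemma posterior_tv_ae (t : R) : b ^+ 2 <= 2^-1 -> 0 < t <= 2^-1 ->
  {ae P, forall w A, measurable A ->
    (`|post (Y w) A - gaussian (Y w) sigma A| <=
      (t / 2 + n%:R * b ^+ 2 * (1 + 2 * M) / t +
       2 * (n%:R * b ^+ 2) / t * noise_energy w)%:E)%E}.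
Proof.
move=> b2 tP; have s0 := noise_sd_gt0.
have st0 : 0 < sigma ^+ 2 + tau ^+ 2 by rewrite addr_gt0// exprn_gt0.
pose rho := Num.sqrt (sigma ^+ 2 + tau ^+ 2).
have rho0 : 0 < rho by rewrite sqrtr_gt0.
have rhoE : rho ^+ 2 = sigma ^+ 2 + tau ^+ 2 by rewrite sqr_sqrtr// ltW.
have bE : tau ^+ 2 / rho ^+ 2 = 1 - b.
  rewrite rhoE /shrinkage; apply: (mulIf (lt0r_neq0 st0)).
  by rewrite mulrBl !divfK ?lt0r_neq0// mul1r addrAC subrr add0r.
have := gaussian_posterior s0 tau0 rho0 rhoE postP.
move=> /(theta_Y_ae rho0); apply: filterS => w wpost A mA.
rewrite wpost// bE.
apply: le_trans (gaussian_tv_le (Y w) s0 _ _ b2 _ tP mA) _.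
- by rewrite divr_gt0// mulr_gt0.
- by rewrite divr_ge0 ?sqr_ge0// ltW.
- by rewrite -bE !exprMn [(rho^-1) ^+ 2]exprVn -mulrA mulrC.
rewrite lee_fin -!addrA lerD2l.
move: tP => /andP[t0 _].
rewrite [X in _ <= _ + X]mulrAC -mulrDl ler_pM2r ?invr_gt0//.
(* Here b^2 / sigma^2 becomes n b^2, and k <= n absorbs the term k b^2 into the same quantity. *)
rewrite noise_sd_sqr invrK.
have kn' : (k n)%:R <= n%:R :> R by rewrite ler_nat; case/andP: kn.
have := theta_Y_energy_le w; set S := \sum_(i < _) _; set q := noise_energy w => hS.
have b20 := sqr_ge0 b.
have h1 : (k n)%:R * b ^+ 2 <= n%:R * b ^+ 2 by rewrite ler_wpM2r.
have h2 : b ^+ 2 * n%:R * S <= b ^+ 2 * n%:R * (2 * M + 2 * q).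
  by rewrite ler_wpM2l// mulr_ge0.
nra.
Qed.

(** The almost sure bound after integration: the expected noise energy is at most (k / n) V <= V,
    which contributes the summand [2 * V]. *)
Let bound (t : R) := t / 2 + n%:R * b ^+ 2 * (1 + 2 * M + 2 * V) / t.

Let knV : n%:R * b ^+ 2 * ((k n)%:R * sigma ^+ 2 * V) <= n%:R * b ^+ 2 * V.
Proof.
rewrite ler_wpM2l//; first by rewrite mulr_ge0// sqr_ge0.
rewrite ler_piMl ?normal_moment2_ge0// noise_sd_sqr ler_pdivrMr ?ltr0n// mul1r.
by rewrite ler_nat; case/andP: kn.
Qed.

Let tv_intercept_ge0 t : 0 < t -> 0 <= t / 2 + n%:R * b ^+ 2 * (1 + 2 * M) / t.
Proof.
move=> t0; have [M1 t1] : 0 <= 1 + 2 * M /\ 0 <= t by have := M0; lra.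
apply: addr_ge0; first by lra.
by rewrite divr_ge0// mulr_ge0// mulr_ge0// sqr_ge0.
Qed.

Let tv_slope_ge0 t : 0 < t -> 0 <= 2 * (n%:R * b ^+ 2) / t.
Proof. by move=> /ltW t0; rewrite divr_ge0// mulr_ge0// mulr_ge0// sqr_ge0. Qed.

Let tv_slope_noise t : 0 < t ->
  2 * (n%:R * b ^+ 2) / t * ((k n)%:R * sigma ^+ 2 * V) <=
  2 * (n%:R * b ^+ 2 * V) / t.
Proof.
by move=> t0; rewrite mulrAC ler_pM2r ?invr_gt0//; have := knV; lra.
Qed.

Lemma integral_posterior_tv_le (t : R) : b ^+ 2 <= 2^-1 -> 0 < t <= 2^-1 ->
  (\int[P]_w tv_dist (post (Y w)) (gaussian (Y w) sigma) <= (bound t)%:E)%E.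
Proof.
move=> b2 tP; have /andP[t0 _] := tP.
have nb0 : 0 <= n%:R * b ^+ 2 by rewrite mulr_ge0// sqr_ge0.
apply: le_trans (integral_le_noise_energy
  (a := t / 2 + n%:R * b ^+ 2 * (1 + 2 * M) / t)
  (b := 2 * (n%:R * b ^+ 2) / t) _ _ _ _) _.
- by move=> w; exact: tv_dist_ge0.
- exact: tv_intercept_ge0.
- exact: tv_slope_ge0.
- apply: filterS (posterior_tv_ae b2 tP) => w wpost.
  by apply: ge_ereal_sup => _ [A mA <-]; exact: wpost.
by rewrite lee_fin; have := tv_slope_noise t0; rewrite /bound; lra.
Qed.

(** The posterior mass of the tail is at most its mass under N(Y, sigma^2 I) plus the total
    variation bound. In [4 * V], one half comes from the spread of that Gaussian around Y and the
    other from the expected distance of Y to theta_0. *)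
Lemma integral_posterior_tail_le (t l : R) :
  b ^+ 2 <= 2^-1 -> 0 < t <= 2^-1 -> 0 < l ->
  (\int[P]_w post (Y w) [set theta | (l * Num.sqrt ((k n)%:R / n%:R) <=
       enorm (vsub theta (proj_true theta0 k n)))%R] <=
   (bound t + 4 * V / l ^+ 2)%:E)%E.
Proof.
move=> b2 tP l0; have /andP[t0 _] := tP; have s0 := noise_sd_gt0.
have nb0 : 0 <= n%:R * b ^+ 2 by rewrite mulr_ge0// sqr_ge0.
have V0 : 0 <= V := normal_moment2_ge0 R.
have kn0 : 0 < (k n)%:R / n%:R :> R.
  by rewrite divr_gt0// ltr0n//; case/andP: kn.
set r := l * _; have r0 : 0 < r by rewrite mulr_gt0// sqrtr_gt0.
have rE : r ^+ 2 = l ^+ 2 * ((k n)%:R * sigma ^+ 2).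
  by rewrite exprMn sqr_sqrtr ?(ltW kn0)// noise_sd_sqr.
have r20 : 0 < r ^+ 2 by rewrite exprn_gt0.
set S := [set theta | _].
have mS : measurable S by exact: measurable_enorm_ge.
pose v := (k n)%:R * sigma ^+ 2 * V.
have v0 : 0 <= v by rewrite !mulr_ge0// sqr_ge0.
apply: le_trans (integral_le_noise_energy
  (a := t / 2 + n%:R * b ^+ 2 * (1 + 2 * M) / t + 2 * v / r ^+ 2)
  (b := 2 * (n%:R * b ^+ 2) / t + 2 / r ^+ 2) _ _ _ _) _.
- by move=> w; exact: measure_ge0.
- rewrite addr_ge0 ?tv_intercept_ge0// divr_ge0 ?(ltW r20)//; lra.
- rewrite addr_ge0 ?tv_slope_ge0// divr_ge0 ?(ltW r20)//.
- apply: filterS (posterior_tv_ae b2 tP) => w wpost.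
  have := wpost S mS.
  have := gaussian_tail_le (Y w) (proj_true theta0 k n) r0 s0.
  rewrite -/S (_ : \sum_(i < _) _ = noise_energy w); last first.
    apply: eq_bigr => i _; rewrite !tnth_mktuple /observation.
    by rewrite addrAC subrr add0r.
  have pf : post (Y w) S \is a fin_num.
    rewrite ge0_fin_numE//; apply: le_lt_trans (ltry 1).
    by rewrite -(prob_kernel (s := post) (Y w)) le_measure ?inE.
  have gf : gaussian (Y w) sigma S \is a fin_num by rewrite fin_num_measure.
  rewrite -(fineK pf) -(fineK gf) !lee_fin /= ler_norml => hg /andP[_ hp].
  move: hg; rewrite (_ : (_ + _) / r ^+ 2 = 2 / r ^+ 2 * noise_energy w + 2 * v / r ^+ 2).
    lra.
  by rewrite /v; move: (sigma ^+ 2) => s2; field; rewrite gt_eqF.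
rewrite lee_fin -/v /bound.
have -> : 4 * V / l ^+ 2 = 4 * v / r ^+ 2.
  have s20 : 0 < sigma ^+ 2 by rewrite exprn_gt0.
  have kn1 : 0 < (k n)%:R :> R by rewrite ltr0n; case/andP: kn.
  rewrite rE /v; move: (sigma ^+ 2) s20 => s2 s20.
  by field; rewrite !gt_eqF.
rewrite mulrDl.
by have := tv_slope_noise t0; rewrite -/v; lra.
Qed.

End sequence_model.

(** * Limits as n tends to infinity *)

Lemma cvge_to0 (R : realType) (f : nat -> \bar R) :
  (forall n, 0 <= f n)%E ->
  (forall e : R, 0 < e -> \forall n \near \oo, (f n <= e%:E)%E) ->
  f n @[n --> \oo] --> 0%E.
Proof.
move=> f0 fe.
have fin : \forall n \near \oo, f n \is a fin_num.
  apply: filterS (fe 1 ltr01) => n fn1.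
  by rewrite ge0_fin_numE// (le_lt_trans fn1)// ltry.
apply/fine_cvgP; split=> //; apply/cvgrPdist_le => e e0.
near=> n; rewrite /= sub0r normrN ger0_norm ?fine_ge0// -lee_fin fineK.
  by near: n; exact: fe.
by near: n.
Unshelve. all: by end_near. Qed.

Lemma in_ell2_bounded_energy (R : realType) (t : nat -> R) (k : nat -> nat) :
  in_ell2 t -> bounded_energy (fun _ => t) k.
Proof.
move=> ht; exists (limn (series (fun j => t j ^+ 2))) => n _.
have := nondecreasing_cvgn_le _ ht (k n).
rewrite /series/= big_mkord; apply.
by apply: nondecreasing_series => j _ _; exact: sqr_ge0.
Qed.

(** With v = 1 / n one has n b^2 = v / (v + tau^2)^2 <= v / tau^4. The fourth power of the
    hypothesis gives v <= e^4 tau^4, and e <= 1 weakens e^4 to e. *)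
Lemma shrinkage_le (R : realType) n (tau e : R) : (0 < n)%N -> 0 < tau -> 0 < e <= 1 ->
  n%:R `^ (- 4^-1) <= e * tau -> n%:R * shrinkage n tau ^+ 2 <= e.
Proof.
move=> n0 tau0 /andP[e0 e1] h.
have nR0 : 0 < n%:R :> R by rewrite ltr0n.
have h4 : n%:R^-1 <= e * tau ^+ 4.
  have -> : n%:R^-1 = (n%:R `^ (- 4^-1)) ^+ 4 :> R.
    by rewrite -powR_mulrn ?powR_ge0// -powRrM mulNr mulVf// powR_inv1// ltW.
  apply: (@le_trans _ _ ((e * tau) ^+ 4)).
    by rewrite lerXn2r ?nnegrE ?powR_ge0// mulr_ge0 ?ltW.
  rewrite exprMn ler_pM2r ?exprn_gt0// -[leRHS]mulr1 exprS ler_pM2l//.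
  by rewrite exprn_ile1// ltW.
rewrite /shrinkage exprVn sqr_sqrtr ?(ltW nR0)//.
set v := n%:R^-1; have v0 : 0 < v by rewrite invr_gt0.
have st0 : 0 < v + tau ^+ 2 by rewrite addr_gt0// exprn_gt0.
rewrite expr_div_n mulrA ler_pdivrMr ?exprn_gt0//.
rewrite expr2 mulrA (_ : n%:R * v = 1) ?mul1r ?divff ?gt_eqF//.
apply: (le_trans h4); rewrite ler_pM2l//.
have -> : tau ^+ 4 = (tau ^+ 2) ^+ 2 by rewrite -exprM.
by rewrite lerXn2r ?nnegrE ?sqr_ge0 ?(ltW st0)// lerDr (ltW v0).
Qed.

Lemma near_shrinkage_le (R : realType) (tau : nat -> R) (e : R) :
  (forall n, (0 < n)%N -> 0 < tau n) ->
  ((fun n => n%:R `^ (- 4^-1)) : nat -> R^o) =o_\oo (tau : nat -> R^o) ->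
  0 < e -> \forall n \near \oo, n%:R * shrinkage n (tau n) ^+ 2 <= e.
Proof.
move=> tau0 /eqoP tauo e0.
have m0 : 0 < Num.min 1 e by rewrite lt_min ltr01.
near=> n.
have n0 : (0 < n)%N by near: n; exact: nbhs_infty_gt.
apply: (@le_trans _ _ (Num.min 1 e)); last by rewrite ge_min lexx orbT.
apply: shrinkage_le => //; [exact: tau0|by rewrite m0 ge_min lexx|].
have : `|n%:R `^ (- 4^-1)| <= Num.min 1 e * `|tau n| by near: n; exact: tauo.
by rewrite ger0_norm ?powR_ge0// gtr0_norm// tau0.
Unshelve. all: by end_near. Qed.

(** The choice of [t] depends on [e] only and makes the first term at most e / 2; the second falls
    below e / 2 for large n. The condition on b^2 follows from b^2 <= n b^2. *)
Lemma near_tv_bound (R : realType) (tau : nat -> R) (c e : R) :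
  (forall n, (0 < n)%N -> 0 < tau n) ->
  ((fun n => n%:R `^ (- 4^-1)) : nat -> R^o) =o_\oo (tau : nat -> R^o) ->
  0 < c -> 0 < e -> exists2 t : R, 0 < t <= 2^-1 &
  \forall n \near \oo, shrinkage n (tau n) ^+ 2 <= 2^-1 /\
    t / 2 + n%:R * shrinkage n (tau n) ^+ 2 * c / t <= e.
Proof.
move=> tau0 tauo c0 e0; pose t := Num.min 2^-1 e.
have t0 : 0 < t by rewrite lt_min e0 andbT; lra.
have te : t <= e by rewrite ge_min lexx orbT.
have th : t <= 2^-1 by rewrite ge_min lexx.
exists t; first by rewrite t0.
near=> n.
have n0 : (0 < n)%N by near: n; exact: nbhs_infty_gt.
have n1 : 1 <= n%:R :> R by rewrite ler1n.
have h1 : n%:R * shrinkage n (tau n) ^+ 2 <= 2^-1.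
  by near: n; apply: near_shrinkage_le => //; lra.
have h2 : n%:R * shrinkage n (tau n) ^+ 2 <= e * t / (2 * c).
  by near: n; apply: near_shrinkage_le => //; rewrite divr_gt0 ?mulr_gt0.
split; first by apply: le_trans h1; rewrite ler_peMl// sqr_ge0.
move: h2; rewrite ler_pdivlMr ?mulr_gt0// => h2.
have : n%:R * shrinkage n (tau n) ^+ 2 * c / t <= e / 2.
  by rewrite ler_pdivrMr//; lra.
lra.
Unshelve. all: by end_near. Qed.

Unset Implicit Arguments.

Theorem proposition1 (R : realType) (d : measure_display)
    (Omega : measurableType d) (P : probability Omega R)
    (xi : nat -> {RV P >-> R}) (hxi : iid_standard_normal xi)
    (k : nat -> nat) (hk : forall n, (0 < n)%N -> (1 <= k n <= n)%N) :
  (forall t : nat -> R, in_ell2 t -> bounded_energy (fun _ => t) k) /\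
  (forall (theta0 : nat -> nat -> R) (tau : nat -> R)
      (post : forall n, R.-pker (Rvec R (k n)) ~> (Rvec R (k n))),
    bounded_energy theta0 k ->
    (forall n, (0 < n)%N -> 0 < tau n) ->
    ((fun n => n%:R `^ (- 4^-1)) : nat -> R^o) =o_\oo (tau : nat -> R^o) ->
    (forall n, (0 < n)%N ->
      is_posterior (gaussian (zerov R (k n)) (tau n))
                   (fun theta => gaussian theta (Num.sqrt n%:R)^-1)
                   (post n)) ->
    ((\int[P]_w tv_dist (post n (theta_Y theta0 xi k n w))
                        (gaussian (theta_Y theta0 xi k n w)
                                  (Num.sqrt n%:R)^-1))%E
       @[n --> \oo] --> 0%E) /\
    (forall lambda : nat -> R, lambda n @[n --> \oo] --> +oo ->
      (\int[P]_w post n (theta_Y theta0 xi k n w)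
         [set theta | (lambda n * Num.sqrt ((k n)%:R / n%:R) <=
                       enorm (vsub theta (proj_true theta0 k n)))%R])%E
       @[n --> \oo] --> 0%E)).
Proof.
split=> [t|theta0 tau post [M energyM] tau0 tauo postP].
  exact: in_ell2_bounded_energy.
have V0 := normal_moment2_ge0 R.
pose c := 1 + 2 * M + 2 * normal_moment2 R.
have c0 : 0 < c.
  have : 0 <= M.
    by apply: le_trans (energyM 1 isT); rewrite sumr_ge0// => j _; exact: sqr_ge0.
  rewrite /c; lra.
split=> [|lambda lambdaoo]; apply: cvge_to0.
- by move=> n; apply: integral_ge0 => w _; exact: tv_dist_ge0.
- move=> e e0; have [t tP tvn] := near_tv_bound tau0 tauo c0 e0.
  near=> n; have n0 : (0 < n)%N by near: n; exact: nbhs_infty_gt.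
  have [b2 tve] : shrinkage n (tau n) ^+ 2 <= 2^-1 /\
      t / 2 + n%:R * shrinkage n (tau n) ^+ 2 * c / t <= e by near: n.
  apply: le_trans (integral_posterior_tv_le hxi n0 (tau0 n n0) (hk n n0)
    (postP n n0) (energyM n n0) b2 tP) _.
  by rewrite lee_fin.
- by move=> n; apply: integral_ge0.
move=> e e0; have e20 : 0 < e / 2 by rewrite divr_gt0.
have [t tP tvn] := near_tv_bound tau0 tauo c0 e20.
near=> n; have n0 : (0 < n)%N by near: n; exact: nbhs_infty_gt.
have [b2 tve] : shrinkage n (tau n) ^+ 2 <= 2^-1 /\
    t / 2 + n%:R * shrinkage n (tau n) ^+ 2 * c / t <= e / 2 by near: n.
(* The summand 1 ensures lambda^2 >= lambda, so lambda >= 8 V / e already gives 4 V / lambda^2 <= e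
   / 2; it also makes [lambda n] positive. *)
have ln : 1 + 8 * normal_moment2 R / e <= lambda n.
  by near: n; move/cvgryPge: lambdaoo; exact.
have Ve0 : 0 <= 8 * normal_moment2 R / e by rewrite divr_ge0 ?mulr_ge0// ltW.
have l0 : 0 < lambda n by lra.
apply: le_trans (integral_posterior_tail_le hxi n0 (tau0 n n0) (hk n n0)
  (postP n n0) (energyM n n0) b2 tP l0) _.
rewrite lee_fin [leRHS](splitr e); apply: lerD => //.
rewrite ler_pdivrMr ?exprn_gt0//.
have : 8 * normal_moment2 R <= lambda n * e by rewrite -ler_pdivrMr//; lra.
nra.
Unshelve. all: by end_near. Qed.
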